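(* Let $J_\delta$, $\delta>0$, be a standard mollifier on $\mathbb T$. Let $R,S\in L^\infty([0,T];L^2(\mathbb T))\cap L^2([0,T];H^1(\mathbb T))$, and set $R_\delta:=R*J_\delta$, $S_\delta:=S*J_\delta$ (convolution in $x$). Let $u:=\mathfrak u(R,S)$ and $u^\delta:=\mathfrak u(R_\delta,S_\delta)$. Then, as $\delta\downarrow0$, $$\int_0^T\int_{\mathbb T}\big|c(u^\delta)\,\partial_xR_\delta-(c(u)\,\partial_xR)*J_\delta\big|^2\,\mathrm dx\,\mathrm dt\to0,$$ $$\int_0^T\int_{\mathbb T}\big|\tilde c(u^\delta)(R_\delta-S_\delta)R_\delta-\big(\tilde c(u)(R-S)R\big)*J_\delta\big|^2\,\mathrm dx\,\mathrm dt\to0.$$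
   Context: $\mathbb T=[0,1]$ with periodic boundary, $T>0$ fixed. There is a constant $\kappa>1$ such that $c\in C^1(\mathbb R)$, $c:\mathbb R\to[\kappa^{-1},\kappa]$ and $|c'|\le\kappa$; $\tilde c:=c'/(4c)$. $F(v):=\int_0^vc(r)\,\mathrm dr$, a bi-Lipschitz bijection of $\mathbb R$. For a function $f$ on $\mathbb T$, $$(\partial_x^{-1}f)(x):=\int_0^xf(y)\,\mathrm dy-x\int_{\mathbb T}f(y)\,\mathrm dy-\int_{\mathbb T}\Big[\int_0^yf(z)\,\mathrm dz-y\int_{\mathbb T}f(z)\,\mathrm dz\Big]\mathrm dy,$$ and $\mathfrak u(G,H)(t,x):=F^{-1}\big(\partial_x^{-1}\tfrac{G(t,\cdot)-H(t,\cdot)}2\big)(x)$. Standard mollifier: $J_\delta(x)=\delta^{-1}J(x/\delta)$. *)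

(* Defs.v *)
(* The torus is [0, 1] with its endpoints identified.  A function on the torus
   is represented by f : K -> K, of which only the values on `[0, 1] matter,
   and a function on [0, T] x torus by f : K -> K -> K, applied to t, then x. *)
From HB Require Import structures.
From mathcomp Require Import all_boot all_order all_algebra.
From mathcomp Require Import all_classical all_reals all_analysis.

Set Implicit Arguments.
Unset Strict Implicit.
Unset Printing Implicit Defensive.

Import Order.TTheory GRing.Theory Num.Theory.
Import numFieldNormedType.Exports.

Local Open Scope classical_set_scope.
Local Open Scope ring_scope.

Section Defs.
Context {K : realType}.
Implicit Types (f g phi J c : K -> K) (G H : K -> K -> K) (T delta t x v : K).

Local Notation mu := (@lebesgue_measure K).

Definition ctilde c v : K := derive1 c v / (4 * c v).

(* One of the two sets is empty or a point, so this is the oriented integral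
   of c from 0 to v. *)
Definition Fint c v : K :=
  \int[mu]_(r in `[0, v]) c r - \int[mu]_(r in `[v, 0]) c r.

Definition Finv c : K -> K := 'pinv_(fun=> 0) [set: K] (Fint c).

Definition dxinv f x : K :=
  \int[mu]_(y in `[0, x]) f y - x * \int[mu]_(y in `[0, 1]) f y
  - \int[mu]_(y in `[0, 1])
      (\int[mu]_(z in `[0, y]) f z - y * \int[mu]_(z in `[0, 1]) f z).

Definition ufrak c G H t x : K :=
  Finv c (dxinv (fun y => (G t y - H t y) / 2) x).

Definition smooth phi : Prop := forall n x, derivable (derive1n n phi) x 1.

Definition standard_mollifier J : Prop :=
  [/\ smooth J, forall x, 0 <= J x, forall x, 1 < `|x| -> J x = 0
    & (\int[mu]_x (J x)%:E = 1)%E].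

Definition mollifier J delta x : K := delta^-1 * J (x / delta).

Definition periodize f x : K := f (x - (Num.floor x)%:~R).

(* The mollifier on the torus is the sum of the integer translates of
   mollifier J delta; the convolution over the torus with that sum is the
   convolution over the line of the periodic extension with mollifier J delta. *)
Definition mollify J delta f x : K :=
  \int[mu]_y (periodize f (x - y) * mollifier J delta y).

Definition torus_test phi : Prop :=
  smooth phi /\ forall x, phi (x + 1) = phi x.

Definition weak_derivative f g : Prop :=
  [/\ mu.-integrable `[0, 1] (EFin \o f),
      mu.-integrable `[0, 1] (EFin \o g)
    & forall phi, torus_test phi ->
        \int[mu]_(x in `[0, 1]) (f x * derive1 phi x) =
        - \int[mu]_(x in `[0, 1]) (g x * phi x)].

Definition jointly_measurable T G : Prop :=
  @measurable_fun _ _ (measurableTypeR K * measurableTypeR K)%type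
    (measurableTypeR K) (`[0, T] `*` `[0, 1]) (fun p => G p.1 p.2).

Definition weak_dx T G H : Prop :=
  jointly_measurable T H /\
  {ae mu, forall t, t \in `[0, T] -> weak_derivative (G t) (H t)}.

Definition L2norm f : \bar K := ('N[mu]_2%:E[(EFin \o f) \_ `[0%R, 1%R]])%E.

(* The Bochner spaces below are described through jointly measurable
   representatives; for L2 and H1 of the torus, which are separable, every
   strongly measurable class has one. *)
Definition in_Linf_L2 T G : Prop :=
  jointly_measurable T G /\
  ('N[mu]_+oo[(fun t => L2norm (G t)) \_ `[0%R, T]] < +oo)%E.

Definition in_L2_H1 T G : Prop :=
  jointly_measurable T G /\
  exists2 H, weak_dx T G H &
    (\int[mu]_(t in `[0%R, T]) (L2norm (G t) ^+ 2 + L2norm (H t) ^+ 2)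
       < +oo)%E.

End Defs.

(* Main.v *)
(* The integral of a nonnegative function is a supremum over simple functions
   below it, so a dominated convergence theorem with varying dominators holds
   without measurability of the functions converging to 0 (lower_pratt); hence
   only the data and the dominators have to be measurable.

   Fix a time t, and write f_d for the mollification of f.  At Lebesgue points
   f_d -> f, the torus integral of (f^2)_d is that of f^2, and Jensen gives
   (f_d)^2 <= (f^2)_d.  So if |a_d| and |b| are at most A and a_d -> b almost
   everywhere, then |a_d q_d - (b q)_d|^2 has a dominator P_d with P integrable,
   its integral tends to 0 and is at most 4 A^2 |q|_2^2.

   Testing the weak derivative against the periodic extension of the mollifier
   centred at x gives (f_d)' = (f')_d.  Hence |f_d| and |f| are bounded by
   |f|_1 + |f'|_1, and weak derivatives are unique.  Since F^-1 is Lipschitz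
   and R_d -> R, S_d -> S in L^1, u^d -> u at every x.  The commutator bound
   then applies with b = c(u), q = R_x, and with b = ctilde(u) (R - S), q = R.
   In time both integrals are dominated by a multiple of
   |R|_2^2 + |R_x|_2^2 + |S|_2^2 + |S_x|_2^2, using for the second one
   that |R(t)|_2 is bounded uniformly in t. *)
Require Import Defs.
From HB Require Import structures.
From mathcomp Require Import all_boot all_order all_algebra.
From mathcomp Require Import all_classical all_reals all_analysis.
From mathcomp Require Import measurable_realfun ess_sup_inf ring lra.
Import Order.TTheory GRing.Theory Num.Theory.
Import numFieldNormedType.Exports.
Local Open Scope classical_set_scope.
Local Open Scope ring_scope.

Set Implicit Arguments.
Unset Strict Implicit.
Unset Printing Implicit Defensive.

(** * Integrals of nonnegative, possibly nonmeasurable functions *)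

Section LowerIntegral.
Local Open Scope ereal_scope.
Context d (T : measurableType d) (R : realType).
Variable mu : {measure set T -> \bar R}.
Implicit Types (D N : set T) (f g : T -> \bar R).

Import HBNNSimple.

(** Two dominations of different kinds are at work. In space no fixed integrable function is at hand
    above all the squares (f_d)^2: the maximal function of an integrable f^2 need not be integrable.
    The dominator therefore moves with d, and the conservation of its integral replaces its being
    fixed. In time the bound left by the spatial step no longer involves d, so one fixed dominator
    is enough.

    Dropping the measurability of the integrands spares a proof that u^d, built at each time from
    primitives and the inverse of F, and all products with it, are jointly measurable in t and x.

    Fatou's lemma is sequential, so limits at 0 from the right are reduced to sequences. These stay
    below 1/2, so that the support of the mollifier, of length 2d, fits inside one period with a
    margin.

    Membership in L^2 H^1 comes with some weak derivative of R of finite norm, while the first claim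
    concerns a given one, about whose norm nothing is assumed; uniqueness carries the bound over. *)

Lemma ge0_cvge0 (I : Type) (F : set_system I) {FF : Filter F} (u : I -> \bar R) :
  (forall i, 0 <= u i) ->
  (forall e : R, (0 < e)%R -> \forall i \near F, u i <= e%:E) ->
  u i @[i --> F] --> 0.
Proof.
move=> u0 ue; apply/fine_cvgP; split.
  near=> i; rewrite ge0_fin_numE//; apply: (@le_lt_trans _ _ 1%:E); last exact: ltey.
  by near: i; exact: ue.
apply/cvgrPdist_le => e e0; near=> i; rewrite /= sub0r normrN.
have : u i <= e%:E by near: i; exact: ue.
case: (u i) (u0 i) => [r| |]//=; rewrite ?normr0 ?(ltW e0)// !lee_fin => r0 re.
by rewrite ger0_norm.
Unshelve. all: by end_near. Qed.

Lemma ge0_integral_approx D f (C : \bar R) : measurable D ->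
  (forall x, D x -> 0 <= f x) -> C < \int[mu]_(x in D) f x ->
  exists2 s : {nnsfun T >-> R}, (forall x, (s x)%:E <= (f \_ D) x) &
     C < \int[mu]_(x in D) (s x)%:E.
Proof.
move=> mD f0; rewrite ge0_integralE// => /ereal_sup_gt[_ [s /= sf <-] Cs].
exists s => //; apply: (lt_le_trans Cs).
rewrite integral_mkcond [leLHS](_ : _ = \int[mu]_x (s x)%:E); last first.
  by rewrite integral_nnsfun// patch_setT.
rewrite le_eqVlt; apply/orP; left; apply/eqP; apply: eq_integral => x _.
rewrite /patch; case: ifPn => // xD.
(* Off [D] the restriction of [f] is 0, so [s], squeezed between 0 and it, vanishes there. *)
apply/eqP; rewrite eq_le lee_fin; apply/andP; split; last by rewrite lee_fin.
by have := sf x; rewrite /patch (negbTE xD).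
Qed.

Lemma ge0_le_integral_lower D f g : measurable D ->
  (forall x, D x -> 0 <= f x) -> (forall x, D x -> f x <= g x) ->
  \int[mu]_(x in D) f x <= \int[mu]_(x in D) g x.
Proof.
move=> mD f0 fg.
rewrite !ge0_integralE//; last by move=> x Dx; exact: le_trans (f0 _ Dx) (fg _ Dx).
apply: ge_ereal_sup => _ [s /= sf <-]; apply: ereal_sup_ubound; exists s => //= x.
by apply: le_trans (sf x) _; exact: lee_restrict.
Qed.

(** A strict excess over [D] would already be attained by a simple function below [f]; that one is
    measurable, so removing the null set [N] does not change its integral. *)
Lemma ge0_integral_setD_negligible D N f : measurable D -> measurable N ->
  mu N = 0 -> (forall x, D x -> 0 <= f x) ->
  \int[mu]_(x in D) f x <= \int[mu]_(x in D `\` N) f x.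
Proof.
move=> mD mN N0 f0; rewrite leNgt; apply/negP.
move=> /(ge0_integral_approx mD f0)[s sf]; apply/negP; rewrite -leNgt.
rewrite (@ge0_negligible_integral _ _ _ mu D N)//; last 2 first.
- exact/measurable_EFinP/measurable_funTS.
- by move=> x _; rewrite lee_fin.
apply: ge0_le_integral_lower; first exact: measurableD.
- by move=> x _; rewrite lee_fin.
- by move=> x [Dx _]; have := sf x; rewrite /patch mem_set.
Qed.

(** The null set is removed on the side of [f] by an inequality, and put back on the side of [g],
    where measurability gives equality. *)
Lemma ae_ge0_le_integral_lower D f g : measurable D ->
  (forall x, D x -> 0 <= f x) -> (forall x, D x -> 0 <= g x) ->
  measurable_fun D g -> {ae mu, forall x, D x -> f x <= g x} ->
  \int[mu]_(x in D) f x <= \int[mu]_(x in D) g x.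
Proof.
move=> mD f0 g0 mg [N [mN N0 fgN]].
apply: (le_trans (ge0_integral_setD_negligible mD mN N0 f0)).
rewrite [leRHS](@ge0_negligible_integral _ _ _ mu D N)//.
apply: ge0_le_integral_lower; first exact: measurableD.
- by move=> x [Dx _]; exact: f0.
- move=> x [Dx Nx]; apply: contrapT => fg; apply/Nx/fgN => /= /(_ Dx).
  exact: fg.
Qed.

Lemma limn_einf_gt (u : (\bar R)^nat) c : c < limn_einf u ->
  \forall n \near \oo, c < u n.
Proof.
rewrite limn_einf_lim (cvg_lim _ (@cvg_einfs_sup R u))//.
move=> /ereal_sup_gt[_ [N _ <-] cN]; exists N => // n /= Nn.
by apply: (lt_le_trans cN); apply: ereal_inf_lbound; exists n.
Qed.

Let pratt_everywhere D (E G : (T -> \bar R)^nat) (F : T -> \bar R) :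
  measurable D ->
  (forall n x, D x -> 0 <= E n x) ->
  (forall n, measurable_fun D (G n)) ->
  (forall n, \int[mu]_(x in D) G n x = \int[mu]_(x in D) F x) ->
  measurable_fun D F ->
  \int[mu]_(x in D) F x < +oo ->
  (forall n x, D x -> E n x <= G n x) ->
  (forall x, D x -> E ^~ x @ \oo --> 0) ->
  (forall x, D x -> G ^~ x @ \oo --> F x) ->
  \int[mu]_(x in D) E n x @[n --> \oo] --> 0.
Proof.
move=> mD E0 mG intG mF intF EG Ecvg Gcvg.
have G0 n x : D x -> 0 <= G n x.
  by move=> Dx; exact: le_trans (E0 n x Dx) (EG n x Dx).
have F0 x : D x -> 0 <= F x.
  move=> Dx; rewrite -(cvg_lim _ (Gcvg x Dx))//; apply: lime_ge.
    by apply/cvg_ex; eexists; exact: Gcvg.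
  by apply: nearW => n; exact: G0.
have IE0 n : 0 <= \int[mu]_(x in D) E n x by apply: integral_ge0 => x; exact: E0.
have Ifin n : \int[mu]_(x in D) E n x \is a fin_num.
  rewrite ge0_fin_numE//; apply: le_lt_trans intF; rewrite -(intG n).
  by apply: ge0_le_integral_lower => // x; [exact: E0|exact: EG].
(* The integral of [E n] is finite, so subtracting 1/(n+1) decreases it strictly and some simple
   function exceeds the result. *)
have /choice[s sP] n : exists s : {nnsfun T >-> R},
    (forall x, (s x)%:E <= (E n \_ D) x) /\
    \int[mu]_(x in D) E n x - n.+1%:R^-1%:E <= \int[mu]_(x in D) (s x)%:E.
  have [|s sE sC] := @ge0_integral_approx D (E n)
      (\int[mu]_(x in D) E n x - n.+1%:R^-1%:E) mD (E0 n).
    by rewrite lteBlDr// lteDl// lte_fin.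
  by exists s; split => //; exact: ltW.
have sE n x : D x -> (s n x)%:E <= E n x.
  by move=> Dx; have := (sP n).1 x; rewrite /patch mem_set.
have ms n : measurable_fun D (fun x => (s n x)%:E).
  exact/measurable_EFinP/measurable_funTS.
have iG n : mu.-integrable D (G n).
  apply/integrableP; split => //; rewrite (eq_integral (G n)) ?intG// => x.
  by rewrite inE => Dx; rewrite gee0_abs// G0.
have is_ n : mu.-integrable D (fun x => (s n x)%:E).
  apply: (le_integrable mD _ _ (iG n)) => // x Dx.
  rewrite gee0_abs ?lee_fin// gee0_abs ?G0//.
  by rewrite (le_trans (sE n x Dx))// EG.
have := @fatou _ _ _ mu D mD (fun n x => G n x - (s n x)%:E).
have -> : \int[mu]_(x in D) limn_einf (fun n => G n x - (s n x)%:E) =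
    \int[mu]_(x in D) F x.
  apply: eq_integral => x; rewrite inE => Dx.
  have := @cvg_limn_einf_sup R (fun n => G n x - (s n x)%:E) (F x - 0).
  rewrite sube0 => -[]// .
  rewrite -[F x]sube0; apply: cvgeB; first by rewrite fin_num_adde_defl.
    exact: Gcvg.
  apply: (@squeeze_cvge _ _ _ _ (cst 0) _ (E ^~ x)).
  - by apply: nearW => n; rewrite lee_fin sE//= fun_ge0.
  - exact: cvg_cst.
  - exact: Ecvg.
move=> /(_ (fun n => emeasurable_funB (mG n) (ms n))).
have Gs0 n x : D x -> 0 <= G n x - (s n x)%:E.
  by move=> Dx; rewrite sube_ge0// (le_trans (sE n x Dx))// EG.
move=> /(_ Gs0).
rewrite (_ : (fun n => _) = (fun n => \int[mu]_(x in D) F x - \int[mu]_(x in D) (s n x)%:E)); last first.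
  by apply/funext => n; rewrite integralB// intG.
set A := \int[mu]_(x in D) F x => AE.
have A0 : A \is a fin_num by rewrite ge0_fin_numE// integral_ge0.
(* Fatou bounds the finite [A] by the lower limit of [A] minus the integral of [s n]. So that
   integral is eventually below e/2, and the slack 1/(n+1) takes the other half of [e]. *)
apply: ge0_cvge0 => // e e0; near=> n.
have h1 : A - (e / 2)%:E < A - \int[mu]_(x in D) (s n x)%:E.
  near: n; apply: limn_einf_gt; apply: (lt_le_trans _ AE).
  by rewrite lteBlDr// lteDl// lte_fin divr_gt0.
have h2 : (n.+1%:R^-1 <= e / 2)%R.
  near: n; exists (Num.truncn (e / 2)^-1) => // n /= ne.
  rewrite -[leRHS]invrK lef_pV2 ?posrE ?invr_gt0 ?divr_gt0//.
  apply: ltW; rewrite (lt_le_trans (truncnS_gt _))// ler_nat.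
  by rewrite ltnS.
have h3 := (sP n).2.
have fs : \int[mu]_(x in D) (s n x)%:E \is a fin_num by exact: integrable_fin_num.
move: h1 h3; rewrite -(fineK (Ifin n)) -(fineK fs) -(fineK A0) -!EFinB lte_fin !lee_fin.
rewrite ltrD2l ltrN2 => h1; rewrite lerBlDr => h3; apply: (le_trans h3).
by rewrite (splitr e) lerD// ltW.
Unshelve. all: by end_near. Qed.

(* [E] need not be measurable: its integral is nearly attained by simple
   functions [s n <= E n], and Fatou's lemma applies to [G n - s n]. *)
Lemma lower_pratt D (E G : (T -> \bar R)^nat) (F : T -> \bar R) :
  measurable D ->
  (forall n x, D x -> 0 <= E n x) ->
  (forall n, measurable_fun D (G n)) -> (forall n x, D x -> 0 <= G n x) ->
  measurable_fun D F -> (forall x, D x -> 0 <= F x) ->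
  (forall n, \int[mu]_(x in D) G n x = \int[mu]_(x in D) F x) ->
  \int[mu]_(x in D) F x < +oo ->
  {ae mu, forall x n, D x -> E n x <= G n x} ->
  {ae mu, forall x, D x -> E ^~ x @ \oo --> 0} ->
  {ae mu, forall x, D x -> G ^~ x @ \oo --> F x} ->
  \int[mu]_(x in D) E n x @[n --> \oo] --> 0.
Proof.
move=> mD E0 mG G0 mF F0 intG intF EG Ec Gc.
have [N [mN N0 NP]] : {ae mu, forall x, D x -> [/\ forall n, E n x <= G n x,
    E ^~ x @ \oo --> 0 & G ^~ x @ \oo --> F x]}.
  near=> x.
  have h1 : forall n, D x -> E n x <= G n x by near: x.
  have h2 : D x -> E ^~ x @ \oo --> 0 by near: x.
  have h3 : D x -> G ^~ x @ \oo --> F x by near: x.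
  by move=> Dx; split=> [n||]; [exact: h1|exact: h2|exact: h3].
have P x : (D `\` N) x -> [/\ forall n, E n x <= G n x,
    E ^~ x @ \oo --> 0 & G ^~ x @ \oo --> F x].
  by move=> [Dx Nx]; apply: contrapT => h; apply/Nx/NP => /= /(_ Dx).
have sub : D `\` N `<=` D by move=> x [].
have NI g : measurable_fun D g -> (forall x, D x -> 0 <= g x) ->
    \int[mu]_(x in D `\` N) g x = \int[mu]_(x in D) g x.
  by move=> mg g0; exact/esym/ge0_negligible_integral.
have cvgN := @pratt_everywhere (D `\` N) E G F.
apply: (@squeeze_cvge _ _ _ _ (cst 0) _ (fun n => \int[mu]_(x in D `\` N) E n x)).
- apply: nearW => n; rewrite integral_ge0//=; last by move=> x; exact: E0.
  by apply: ge0_integral_setD_negligible => // x; exact: E0.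
- exact: cvg_cst.
- apply: cvgN.
  + exact: measurableD.
  + by move=> n x /sub; exact: E0.
  + by move=> n; exact: measurable_funS (mG n).
  + by move=> n; rewrite !NI//; exact: G0.
  + exact: measurable_funS mF.
  + by rewrite NI.
  + by move=> n x /P[].
  + by move=> x /P[].
  + by move=> x /P[].
Unshelve. all: by end_near. Qed.

Lemma ae_imp (P Q : T -> Prop) : (forall x, P x -> Q x) ->
  {ae mu, forall x, P x} -> {ae mu, forall x, Q x}.
Proof. by move=> PQ; apply: filterS. Qed.

Lemma ae_imp2 (P Q S : T -> Prop) : (forall x, P x -> Q x -> S x) ->
  {ae mu, forall x, P x} -> {ae mu, forall x, Q x} -> {ae mu, forall x, S x}.
Proof. by move=> PQS; apply: filterS2. Qed.

End LowerIntegral.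

(** * Reflections, translations and integrals over a period *)

Section MeasurePreserving.
Context {K : realType}.
Local Notation mu := (@lebesgue_measure K).
Implicit Types (a b x y : K).
Local Open Scope ereal_scope.

(** The pushforward of Lebesgue measure under [g] agrees with it on half-open intervals, hence
    equals it by uniqueness; what remains is the change of variables for a pushforward. *)
Lemma ge0_integral_measure_preserving (g : K -> K) (D : set K) (f : K -> \bar K) :
  measurable_fun setT g ->
  (forall b c, mu (g @^-1` `]b, c]%classic) = mu `]b, c]%classic) ->
  measurable D -> measurable_fun D f -> (forall x, D x -> 0 <= f x) ->
  \int[mu]_(x in D) f x = \int[mu]_(x in g @^-1` D) f (g x).
Proof.
move=> mg gE mD mf f0.
pose mx := isMeasurableFun.Build _ _ (measurableTypeR K) (measurableTypeR K) g mg.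
pose G : {mfun measurableTypeR K >-> measurableTypeR K} := HB.pack g mx.
transitivity (\int[pushforward mu G]_(x in D) f x).
  apply: eq_measure_integral => A mA _.
  by apply: (@lebesgue_measure_unique K (pushforward mu G)) => // _ [[b c] _ <-]; exact/esym/gE.
rewrite ge0_integral_pushforward// => x; rewrite inE; exact: f0.
Qed.

Lemma ge0_integral_reflect a (D : set K) (f : K -> \bar K) :
  measurable D -> measurable_fun D f -> (forall x, D x -> 0 <= f x) ->
  \int[mu]_(x in D) f x = \int[mu]_(x in (fun y => a - y)%R @^-1` D) f (a - x)%R.
Proof.
apply: ge0_integral_measure_preserving; first exact: measurable_funB.
move=> b c; rewrite (_ : _ @^-1` _ = `[a - c, a - b[%classic)%R; last first.
  by apply/seteqP; split => x /=; rewrite !in_itv/= => /andP[? ?]; apply/andP; split; lra.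
rewrite !lebesgue_measure_itv/= !lte_fin -!EFinB.
have -> : (a - c < a - b = (b < c))%R by apply/idP/idP; lra.
by case: ifPn => // _; congr (_%:E); lra.
Qed.

Lemma ge0_integral_shift a (D : set K) (f : K -> \bar K) :
  measurable D -> measurable_fun D f -> (forall x, D x -> 0 <= f x) ->
  \int[mu]_(x in D) f x = \int[mu]_(x in (fun y => y + a)%R @^-1` D) f (x + a)%R.
Proof.
apply: ge0_integral_measure_preserving; first exact: measurable_funD.
move=> b c; rewrite (_ : _ @^-1` _ = `]b - a, c - a]%classic)%R; last first.
  by apply/seteqP; split => x /=; rewrite !in_itv/= => /andP[? ?]; apply/andP; split; lra.
rewrite !lebesgue_measure_itv/= !lte_fin -!EFinB.
have -> : (b - a < c - a = (b < c))%R by apply/idP/idP; lra.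
by case: ifPn => // _; congr (_%:E); lra.
Qed.

Lemma integral_reflect a (f : K -> \bar K) : measurable_fun setT f ->
  \int[mu]_x f (a - x)%R = \int[mu]_x f x.
Proof.
move=> mf; rewrite integralE [RHS]integralE.
rewrite (_ : (fun x => f (a - x)%R)^\+ = fun x => f^\+ (a - x)%R); last first.
  by apply/funext => x; rewrite !funeposE.
rewrite (_ : (fun x => f (a - x)%R)^\- = fun x => f^\- (a - x)%R); last first.
  by apply/funext => x; rewrite !funenegE.
have E g : measurable_fun setT g -> (forall x, 0 <= g x) ->
    \int[mu]_x g (a - x)%R = \int[mu]_x g x.
  by move=> mg g0; rewrite [RHS](@ge0_integral_reflect a)// preimage_setT.
by rewrite !E//; [exact: measurable_funeneg|exact: measurable_funepos].
Qed.

(** Translating by the floor of [a] brings the window to [r, r + 1) with 0 <= r < 1; cutting it at 1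
    and moving the piece [1, r + 1) back to [0, r) completes [0, 1). *)
Lemma ge0_integral_period (h : K -> \bar K) a :
  measurable_fun setT h -> (forall x, 0 <= h x) -> (forall x, h (x + 1)%R = h x) ->
  \int[mu]_(x in `[a, (a + 1)%R]) h x = \int[mu]_(x in `[0%R, 1%R]) h x.
Proof.
move=> mh h0 h1.
have hn (n : nat) x : h (x + n%:R)%R = h x.
  by elim: n => [|n IH]; rewrite ?addr0// -natr1 addrA h1.
have hz (z : int) x : h (x + z%:~R)%R = h x.
  case: z => n; rewrite ?hn// NegzE mulrNz -pmulrn.
  by rewrite -[in RHS](subrK n.+1%:R x)%R hn.
pose n := Num.floor a; pose r := (a - n%:~R)%R.
have r0 : (0 <= r)%R by rewrite subr_ge0 floor_le.
have r1 : (r < 1)%R.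
  by have := floorD1_gt a; rewrite -/n intrD -/n /r; lra.
have mT A : measurable_fun A h by exact: measurable_funS mh.
rewrite -!integral_itv_bndo_bndc//.
transitivity (\int[mu]_(x in `[r, (r + 1)%R[) h x).
  rewrite (@ge0_integral_shift n%:~R)//.
  under eq_integral do rewrite hz.
  congr (integral _ _ _); apply/seteqP; split => x /=; rewrite !in_itv/= /r => /andP[? ?];
    apply/andP; split; lra.
have -> : `[r, (r + 1)%R[%classic = `[r, 1%R[%classic `|` `[1%R, (r + 1)%R[%classic :> set K.
  by rewrite -itv_bndbnd_setU// bnd_simp; lra.
rewrite ge0_integral_setU//; [|exact: mT|]; last first.
  by apply/disj_setPS => x [] /=; rewrite !in_itv/= => /andP[_ ?] /andP[? _]; lra.
have -> : \int[mu]_(x in `[1%R, (r + 1)%R[) h x = \int[mu]_(x in `[0%R, r[) h x.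
  rewrite (@ge0_integral_shift 1)//.
  under eq_integral do rewrite h1.
  congr (integral _ _ _); apply/seteqP; split => x /=; rewrite !in_itv/= /r => /andP[? ?];
    apply/andP; split; lra.
rewrite addeC -ge0_integral_setU//; [|exact: mT|].
  by rewrite -itv_bndbnd_setU// bnd_simp//; lra.
by apply/disj_setPS => x [] /=; rewrite !in_itv/= => /andP[_ ?] /andP[? _]; lra.
Qed.

End MeasurePreserving.

(** * The periodic extension *)

Section Periodize.
Context {K : realType}.
Local Notation mu := (@lebesgue_measure K).
Implicit Types (f : K -> K) (x : K).

Lemma periodizeD1 f x : periodize f (x + 1) = periodize f x.
Proof.
rewrite /periodize -[1]/(1%:~R) floorDrz ?intr_int// intrKfloor intrD.
by congr f; ring.
Qed.

Lemma periodize_id f x : 0 <= x < 1 -> periodize f x = f x.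
Proof.
move=> x01; rewrite /periodize (_ : Num.floor x = 0) ?subr0//.
by apply/eqP; rewrite floor_eq add0r.
Qed.

Lemma frac_itv x : 0 <= x - (Num.floor x)%:~R < 1.
Proof. by have := floor_itv x; rewrite intrD; lra. Qed.

(** The floor is monotone, hence measurable, and fractional parts stay in [0, 1], the only place
    where [f] is known to be measurable. *)
Lemma measurable_periodize f : measurable_fun (`[0, 1] : set K) f ->
  measurable_fun setT (periodize f).
Proof.
move=> mf.
rewrite (_ : periodize f = (f \_ `[0, 1]) \o (fun x => x - (Num.floor x)%:~R)).
  apply: measurableT_comp; first exact/(measurable_restrictT _ _).1.
  apply: measurable_funB => //; apply: nondecreasing_measurable => // x y xy.
  by rewrite ler_int le_floor.
apply/funext => x /=; rewrite /patch mem_set//=.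
by have := frac_itv x; rewrite in_itv/= => /andP[-> /ltW].
Qed.

Lemma ge0_integral_periodize f (a : K) : measurable_fun (`[0, 1] : set K) f -> (forall x, 0 <= f x) ->
  (\int[mu]_(x in `[a, (a + 1)%R]) (periodize f x)%:E = \int[mu]_(x in `[0%R, 1%R]) (f x)%:E)%E.
Proof.
move=> mf f0.
have mp : measurable_fun setT (EFin \o periodize f).
  apply/measurable_EFinP. apply: measurable_periodize. exact: mf.
rewrite (@ge0_integral_period _ (EFin \o periodize f))//; last first.
- by move=> x /=; rewrite periodizeD1.
- by move=> x; rewrite lee_fin /periodize.
(* At 1 the extension takes the value [f 0], so the two integrands are compared on the half-open
   interval. *)
rewrite -!integral_itv_bndo_bndc; last 2 first.
- by apply/measurable_EFinP; apply: measurable_funS mf => //; exact: subset_itv_co_cc.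
- exact: measurable_funS mp.
by apply: eq_integral => x; rewrite inE/= in_itv/= => x01; rewrite periodize_id.
Qed.

End Periodize.

(** * Integrability of the extension, alone and against a kernel *)

Section Kernel.
Context {K : realType}.
Local Notation mu := (@lebesgue_measure K).
Implicit Types (f g psi : K -> K) (a b r M x y z : K).

Lemma integrable_measurable_fun f (D : set K) : mu.-integrable D (EFin \o f) ->
  measurable_fun D f.
Proof. by case/integrableP => /measurable_EFinP. Qed.

(** Every unit window carries the same finite integral of the absolute value, and finitely many
    windows cover [[a, b]]. *)
Lemma integrable_periodize f a b : mu.-integrable `[0, 1] (EFin \o f) ->
  mu.-integrable `[a, b] (EFin \o periodize f).
Proof.
move=> itf; have mf := integrable_measurable_fun itf.
have mp : measurable_fun setT (periodize f) by exact: measurable_periodize.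
have mpS (D : set K) : measurable_fun D (EFin \o periodize f).
  by apply/measurable_EFinP; exact: measurable_funS mp.
pose I := (\int[mu]_(x in `[0%R, 1%R]) `|(f x)%:E|)%E.
have Ioo : (I < +oo)%E by case/integrableP : itf.
have I0 : (0 <= I)%E by exact: integral_ge0.
have mabs (D : set K) : measurable_fun D (fun x => `|(periodize f x)%:E|%E).
  by apply: measurableT_comp.
have step c : (\int[mu]_(x in `[c, (c + 1)%R[) `|(periodize f x)%:E| = I)%E.
  rewrite integral_itv_bndo_bndc//.
  exact: (@ge0_integral_periodize _ (fun x => `|f x|) c (measurableT_comp _ mf)).
have It n : (\int[mu]_(x in `[a, (a + n%:R)%R[) `|(periodize f x)%:E| < +oo)%E.
  elim: n => [|n IH].
    by rewrite addr0 set_itv_ge ?bnd_simp ?ltxx// integral_set0.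
  have -> : `[a, a + n.+1%:R[%classic =
      `[a, a + n%:R[%classic `|` `[a + n%:R, a + n%:R + 1[%classic :> set K.
    by rewrite -itv_bndbnd_setU// ?bnd_simp ?lerDl ?ler0n// -addrA natr1.
  rewrite ge0_integral_setU//; [|exact: mabs|]; last first.
    by apply/disj_setPS => x [] /=; rewrite !in_itv/= => /andP[_ xa] /andP[]; rewrite leNgt xa.
  by rewrite step lte_add_pinfty.
(* The successor makes a + n > b, so the half-open union still contains the endpoint [b]. *)
pose n := (Num.truncn (b - a)).+1.
have itE : mu.-integrable `[a, a + n%:R[ (EFin \o periodize f).
  by apply/integrableP; split; [exact: mpS|exact: It].
apply: integrableS itE => // x /=; rewrite !in_itv/= => /andP[-> xb]/=.
by apply: (le_lt_trans xb); rewrite -ltrBlDl truncnS_gt.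
Qed.

(** The kernel centred at [x] confines the product to [x - r, x + r], where it is a bounded function
    times an integrable one. *)
Lemma integrable_periodizeM f psi x r M : mu.-integrable `[0, 1] (EFin \o f) ->
  measurable_fun setT psi -> (forall y, `|psi y| <= M) ->
  (forall y, r < `|y| -> psi y = 0) ->
  mu.-integrable setT (EFin \o (fun z => periodize f z * psi (x - z))).
Proof.
move=> itf mpsi psiM psi0.
have ip := @integrable_periodize f (x - r) (x + r) itf.
pose h z := periodize f z * psi (x - z).
rewrite (_ : EFin \o _ = (EFin \o h) \_ `[(x - r)%R, (x + r)%R]); last first.
  apply/funext => z; rewrite /patch; case: ifPn => //= /negP; rewrite inE/= in_itv/= => zr.
  rewrite psi0 ?mulr0//; rewrite ltNge; apply/negP => zr'; apply: zr.
  by move: zr'; rewrite ler_norml; lra.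
apply/(integrable_mkcond _ _).1 => //.
rewrite (_ : _ \o _ = ((EFin \o periodize f) \* (EFin \o (fun z => psi (x - z)%R)))%E)//.
apply: integrableMl => //.
  by apply: measurableT_comp => //; exact: measurable_funB.
exists M; split; first exact: num_real.
by move=> N MN z _; apply: (le_trans (psiM _)); exact: ltW.
Qed.

End Kernel.

(** * Smooth functions and their periodic repetition *)

Section Smooth.
Context {K : realType}.
Implicit Types (f g phi : K -> K) (a b c x y z : K).

Lemma is_derive1_affine f a b x : derivable f (a * x + b) 1 ->
  is_derive x (1 : K) (fun y => f (a * y + b)) (a * derive1 f (a * x + b)).
Proof.
move=> df.
have d1 : is_derive x (1 : K) (fun y => a * y + b) a.
  by apply: is_derive_eq; rewrite addr0 /GRing.scale/= mulr1.
have d2 : is_derive (a * x + b) (1 : K) f (derive1 f (a * x + b)).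
  by apply: DeriveDef => //; rewrite derive1E.
rewrite mulrC; exact: (@is_derive1_comp _ f (fun y => a * y + b)).
Qed.

Lemma derive1n_affine f c a b n : smooth f ->
  derive1n n (fun y => c * f (a * y + b)) =
  fun y => c * a ^+ n * derive1n n f (a * y + b).
Proof.
move=> sf; elim: n => [|n IH]; first by apply/funext => y; rewrite expr0 mulr1.
rewrite derive1nS IH; apply/funext => y; rewrite derive1E.
have d := is_derive1_affine (sf n (a * y + b)).
have [_ ->] : is_derive y (1 : K)
   (fun y => c * a ^+ n * derive1n n f (a * y + b))
   (c * a ^+ n * (a * derive1 (derive1n n f) (a * y + b))).
  exact: (@is_deriveZ _ _ _ _ (c * a ^+ n)).
by rewrite derive1nS exprS; ring.
Qed.

Lemma smooth_affine f c a b : smooth f -> smooth (fun y => c * f (a * y + b)).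
Proof.
move=> sf n x; rewrite derive1n_affine//.
have [d _] := is_derive1_affine (sf n (a * x + b)).
exact: (@derivableZ _ _ _ _ (c * a ^+ n)).
Qed.

Lemma smooth_continuous f n : smooth f -> continuous (derive1n n f).
Proof. by move=> sf x; exact/differentiable_continuous/derivable1_diffP/sf. Qed.

(* Weak derivatives are tested on periodic functions, so the mollifier centred
   at x is extended periodically from a window [a, a + 1) containing its support. *)
Definition repeat_from a phi z : K := phi (a + (z - a - (Num.floor (z - a))%:~R)).

Lemma repeat_fromD1 a phi z : repeat_from a phi (z + 1) = repeat_from a phi z.
Proof.
rewrite /repeat_from (_ : z + 1 - a = z - a + 1); last by ring.
rewrite -[1]/(1%:~R) floorDrz ?intr_int// intrKfloor intrD.
by congr phi; ring.
Qed.

Lemma repeat_from_id a phi z : a <= z < a + 1 -> repeat_from a phi z = phi z.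
Proof.
move=> az; rewrite /repeat_from (_ : Num.floor (z - a) = 0).
  by congr phi; ring.
by apply/eqP; rewrite floor_eq add0r; move: az => /andP[? ?]; apply/andP; split; lra.
Qed.

Definition supported_in (a b : K) phi := forall x, (x < a) || (b < x) -> phi x = 0.

(** Between two seams a + k the floor is locally constant. At a seam both sides vanish nearby, since
    [phi] is 0 within [e] of the ends of the window. Derivatives of the repetition thus reduce to
    those of [phi]. *)
Lemma repeat_from_near a e phi z : 0 < e -> supported_in (a + e) (a + 1 - e) phi ->
  \forall y \near z, repeat_from a phi y = phi (y - (Num.floor (z - a))%:~R).
Proof.
move=> e0 supp; set k := (Num.floor (z - a)).
have := floor_itv (z - a); rewrite -/k intrD => /andP[kz zk].
have [ek|] := ltP 0 (z - a - k%:~R).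
- near=> y; rewrite /repeat_from (_ : Num.floor (y - a) = k).
    by congr phi; ring.
  apply/eqP; rewrite floor_eq intrD; apply/andP; split.
    near: y; apply: (cvgr_ge (z - a)); last by lra.
    by apply: cvgB; [exact: cvg_id|exact: cvg_cst].
  near: y; apply: (cvgr_lt (z - a)); last by lra.
  by apply: cvgB; [exact: cvg_id|exact: cvg_cst].
- move=> zk0; have zE : z = a + k%:~R by apply/eqP; rewrite eq_le; apply/andP; split; lra.
  (* Closeness [e] puts [y] where [phi] vanishes; closeness 1/2 leaves only [k] and k - 1 as
     possible floors. *)
  have e' : 0 < Num.min e (2^-1) by rewrite lt_min e0 invr_gt0 ltr0n.
  near=> y.
  have yz : `|z - y| < Num.min e (2^-1).
    by near: y; exact: cvgr_dist_lt (@cvg_id _ _) _ e'.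
  move: yz; rewrite lt_min => /andP[ye y2].
  move: ye y2; rewrite !ltr_norml => /andP[ye1 ye2] /andP[y1 y2].
  have two : 2^-1 + 2^-1 = 1 :> K by field.
  rewrite (supp (y - k%:~R)); last by rewrite zE in ye1 ye2; apply/orP; left; lra.
  rewrite /repeat_from; apply: supp.
  have [ky|ky] := leP (a + k%:~R) y.
    rewrite (_ : Num.floor (y - a) = k); first by apply/orP; left; lra.
    by apply/eqP; rewrite floor_eq intrD; apply/andP; split; lra.
  rewrite (_ : Num.floor (y - a) = k - 1).
    by rewrite intrD intrN; apply/orP; right; lra.
  by apply/eqP; rewrite floor_eq subrK intrD intrN; apply/andP; split; lra.
Unshelve. all: by end_near. Qed.

End Smooth.

(** * Periodic repetitions as test functions on the torus *)

Section RepeatSmooth.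
Context {K : realType}.
Local Notation mu := (@lebesgue_measure K).
Implicit Types (f g h phi : K -> K) (a b c x y z : K).

Lemma is_derive_repeat_from a e phi z : 0 < e ->
  supported_in (a + e) (a + 1 - e) phi -> (forall x, derivable phi x 1) ->
  is_derive z (1 : K) (repeat_from a phi) (repeat_from a (derive1 phi) z).
Proof.
move=> e0 supp dphi.
have nr := repeat_from_near z e0 supp.
set k := (Num.floor (z - a))%:~R in nr.
have d := @is_derive1_affine K phi 1 (- k) z (dphi _).
apply: (@near_eq_is_derive _ _ _ (fun y => phi (1 * y - k))).
  by near=> y; rewrite mul1r; apply/esym; near: y.
suff -> : repeat_from a (derive1 phi) z = 1 * derive1 phi (1 * z - k) by [].
by rewrite /repeat_from !mul1r -/k; congr (derive1 phi _); ring.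
Unshelve. all: by end_near. Qed.

(** Both inequalities describing the outside are strict, so it is open and [phi] vanishes near each
    of its points. *)
Lemma supported_derive1 a b phi : supported_in a b phi -> supported_in a b (derive1 phi).
Proof.
move=> supp x xab; rewrite derive1E (@near_eq_derive _ _ _ phi (cst 0)) ?derive_cst//.
have [xa|] := ltP x a.
- near=> y; apply: supp; apply/orP; left; near: y.
  by apply: (cvgr_lt x) => //; exact: cvg_id.
- move=> ax; have bx : b < x by move: xab; rewrite ltNge ax.
  near=> y; apply: supp; apply/orP; right; near: y.
  by apply: (cvgr_gt x) => //; exact: cvg_id.
Unshelve. all: by end_near. Qed.

Lemma derive1n_repeat_from a e phi n : 0 < e ->
  supported_in (a + e) (a + 1 - e) phi -> smooth phi ->
  derive1n n (repeat_from a phi) = repeat_from a (derive1n n phi) /\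
  supported_in (a + e) (a + 1 - e) (derive1n n phi).
Proof.
move=> e0 supp sphi; elim: n => [//|n [IH1 IH2]].
rewrite !derive1nS IH1; split; last exact: supported_derive1.
apply/funext => z; rewrite derive1E.
by have [_ ->] := is_derive_repeat_from z e0 IH2 (sphi n).
Qed.

Lemma torus_test_repeat_from a e phi : 0 < e ->
  supported_in (a + e) (a + 1 - e) phi -> smooth phi -> torus_test (repeat_from a phi).
Proof.
move=> e0 supp sphi; split; last by move=> x; exact: repeat_fromD1.
move=> n x; have [-> s] := derive1n_repeat_from n e0 supp sphi.
by have [] := is_derive_repeat_from x e0 s (sphi n).
Qed.

Lemma measurable_repeat_from a phi : measurable_fun setT phi ->
  measurable_fun setT (repeat_from a phi).
Proof.
move=> mphi; apply: measurableT_comp => //; apply: measurable_funD => //.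
apply: measurable_funB; first exact: measurable_funB.
apply: nondecreasing_measurable => // x y xy.
by rewrite ler_int le_floor// lerB.
Qed.

Lemma integral_period (k : K -> \bar K) a : measurable_fun setT k ->
  (forall x, k (x + 1) = k x) ->
  (\int[mu]_(x in `[a, (a + 1)%R]) k x = \int[mu]_(x in `[0%R, 1%R]) k x)%E.
Proof.
move=> mk k1; rewrite integralE [RHS]integralE.
rewrite !(@ge0_integral_period _ _ a)//.
- exact: measurable_funeneg.
- by move=> x; rewrite !funenegE k1.
- exact: measurable_funepos.
- by move=> x; rewrite !funeposE k1.
Qed.

(** This converts line integrals into torus integrals: [phi] lives in one window, where it agrees
    with its repetition except possibly at the right end, and a product of two periodic functions
    has the same integral over every window. *)
Lemma Rintegral_periodize h phi a : measurable_fun (`[0, 1] : set K) h ->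
  measurable_fun setT phi -> supported_in a (a + 1) phi ->
  \int[mu]_z (periodize h z * phi z) = \int[mu]_(z in `[0, 1]) (h z * repeat_from a phi z).
Proof.
move=> mh mphi supp; congr fine.
have mper := measurable_periodize mh.
have m1 (D : set K) : measurable_fun D (fun z => (periodize h z * phi z)%:E).
  by apply/measurable_EFinP; apply: measurable_funS (measurable_funM mper mphi).
have mr := measurable_repeat_from a mphi.
have m2 (D : set K) : measurable_fun D (fun z => (periodize h z * repeat_from a phi z)%:E).
  by apply/measurable_EFinP; apply: measurable_funS (measurable_funM mper mr).
transitivity (\int[mu]_(z in `[a, (a + 1)%R]) (periodize h z * phi z)%:E)%E.
  rewrite [RHS]integral_mkcond; apply: eq_integral => z _.
  rewrite /patch; case: ifPn => // /negP; rewrite inE/= in_itv/= => za.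
  rewrite supp ?mulr0//; apply/orP; have [|] := ltP z a; first by left.
  by move=> az; right; rewrite ltNge; apply/negP => za'; apply: za; rewrite az.
rewrite -integral_itv_bndo_bndc; last exact: m1.
transitivity (\int[mu]_(z in `[a, (a + 1)%R[) (periodize h z * repeat_from a phi z)%:E)%E.
  by apply: eq_integral => z; rewrite inE/= in_itv/= => az; rewrite repeat_from_id.
rewrite integral_itv_bndo_bndc; last exact: m2.
rewrite integral_period; last 2 first.
- exact: m2.
- by move=> z; rewrite periodizeD1 repeat_fromD1.
rewrite -integral_itv_bndo_bndc; last exact: m2.
rewrite -[RHS]integral_itv_bndo_bndc; last first.
  apply/measurable_EFinP; apply: measurable_funM.
    by apply: measurable_funS mh => //; exact: subset_itv_co_cc.
  exact: measurable_funS mr.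
by apply: eq_integral => z; rewrite inE/= in_itv/= => az; rewrite periodize_id.
Qed.

End RepeatSmooth.

(** * Integrability of real-valued functions *)

Section RealIntegrable.
Context d (T : measurableType d) (R : realType) (nu : {measure set T -> \bar R}).
Variables (D : set T) (mD : measurable D).
Implicit Types (f g h : T -> R).

Lemma integrable_EFinD f g : nu.-integrable D (EFin \o f) ->
  nu.-integrable D (EFin \o g) -> nu.-integrable D (EFin \o (fun x => f x + g x)).
Proof. by move=> itf itg; exact: (integrableD mD itf itg). Qed.

Lemma integrable_EFinB f g : nu.-integrable D (EFin \o f) ->
  nu.-integrable D (EFin \o g) -> nu.-integrable D (EFin \o (fun x => f x - g x)).
Proof. by move=> itf itg; exact: (integrableB mD itf itg). Qed.

Lemma integrable_EFinZ (k : R) f : nu.-integrable D (EFin \o f) ->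
  nu.-integrable D (EFin \o (fun x => k * f x)).
Proof. by move=> itf; exact: (integrableZl mD k itf). Qed.

Lemma integrable_EFin_norm f : nu.-integrable D (EFin \o f) ->
  nu.-integrable D (EFin \o (fun x => `|f x|)).
Proof. exact: integrable_norm. Qed.

End RealIntegrable.

(** * The mollifier and pointwise inequalities for mollification *)

Section Mollifier.
Context {K : realType}.
Local Notation mu := (@lebesgue_measure K).
Implicit Types (f g h phi J : K -> K) (a b c x y z r M d : K).

Lemma lebesgue_measure_unit_itv : mu (`[0%R, 1%R]%classic : set K) = 1%E.
Proof. by rewrite lebesgue_measure_itv/= lte_fin ltr01 sube0. Qed.

Lemma integrable_unit_cst (r : K) : mu.-integrable `[0, 1] (EFin \o cst r).
Proof.
apply: measurable_bounded_integrable => //.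
  by rewrite [X in (X < _)%E]lebesgue_measure_unit_itv ltey.
by exists `|r|; split => // N Nr z _; exact: ltW.
Qed.

Lemma continuous_support_bounded phi r : continuous phi ->
  (forall x, r < `|x| -> phi x = 0) -> exists2 M, 0 < M & forall x, `|phi x| <= M.
Proof.
move=> cphi supp.
have : compact (phi @` `[- r, r]).
  by apply: continuous_compact; [exact: continuous_subspaceT|exact: segment_compact].
move=> /compact_bounded[M [_ MP]].
exists (Num.max M 0 + 1); first by rewrite ltr_pwDr// le_max lexx orbT.
move=> x; have [xr|rx] := leP `|x| r; last first.
  by rewrite supp// normr0 addr_ge0// le_max lexx orbT.
apply: (MP (Num.max M 0 + 1)); first by rewrite (@le_lt_trans _ _ (Num.max M 0)) ?le_max ?lexx ?ltrDl.
by exists x => //=; rewrite in_itv/= -ler_norml.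
Qed.

Variable J : K -> K.
Hypothesis hJ : standard_mollifier J.

Let sJ : smooth J. Proof. by case: hJ. Qed.

Lemma mollifier_smooth d : smooth (mollifier J d).
Proof.
rewrite (_ : mollifier J d = fun y => d^-1 * J (d^-1 * y + 0)).
  exact: smooth_affine.
by apply/funext => y; rewrite /mollifier addr0 mulrC (mulrC y) mulrC.
Qed.

Lemma mollifier_ge0 d x : 0 < d -> 0 <= mollifier J d x.
Proof. by case: hJ => _ J0 _ _ d0; rewrite mulr_ge0// invr_ge0 ltW. Qed.

Lemma mollifier_supp d x : 0 < d -> d < `|x| -> mollifier J d x = 0.
Proof.
case: hJ => _ _ Js _ d0 dx; rewrite /mollifier Js ?mulr0//.
by rewrite normrM normfV (gtr0_norm d0) ltr_pdivlMr// mul1r.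
Qed.

Lemma continuous_mollifier d : continuous (mollifier J d).
Proof. exact: (smooth_continuous (n := 0) (@mollifier_smooth d)). Qed.

Lemma measurable_mollifier d : measurable_fun setT (mollifier J d).
Proof. by apply: continuous_measurable_fun; exact: continuous_mollifier. Qed.

Lemma mollifier_le : exists2 M, 0 < M & forall d x, 0 < d -> mollifier J d x <= M / d.
Proof.
have [_ J0 Js _] := hJ.
have [M M0 JM] := continuous_support_bounded (smooth_continuous (n := 0) sJ) Js.
exists M => // d x d0; rewrite /mollifier mulrC ler_pM2r ?invr_gt0//.
exact: le_trans (ler_norm _) (JM _).
Qed.

Lemma integral_mollifier d : 0 < d -> (\int[mu]_y (mollifier J d y)%:E = 1)%E.
Proof.
move=> d0; have [_ J0 _ J1] := hJ; rewrite -J1.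
have D x : is_derive x (1 : K) (fun y => d^-1 * y) d^-1.
  by apply: is_derive_eq; rewrite /GRing.scale/= mulr1.
have DE : derive1 (fun y => d^-1 * y) = cst d^-1.
  by apply/funext => x; rewrite derive1E; have [_ ->] := D x.
have di : 0 < d^-1 by rewrite invr_gt0.
rewrite [RHS](@increasing_ge0_integration_by_substitutionT _ (fun y => d^-1 * y)).
- apply: eq_integral => y _; congr (_%:E).
  by rewrite DE /mollifier /= mulrC (mulrC y).
- by move=> x y xy; rewrite ltr_pM2l.
- by rewrite DE; exact: cst_continuous.
- by rewrite DE; exact: is_cvg_cst.
- by rewrite DE; exact: is_cvg_cst.
- by move=> x; have [] := D x.
- exact: gt0_cvgMrNy.
- exact: gt0_cvgMry.
- exact: (smooth_continuous (n := 0) sJ).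
- exact: J0.
Qed.

Variable d : K.
Hypothesis d0 : 0 < d.

Lemma integrable_mollify_integrand f x : mu.-integrable `[0, 1] (EFin \o f) ->
  mu.-integrable setT (EFin \o (fun z => periodize f z * mollifier J d (x - z))).
Proof.
move=> itf; have [M M0 JM] := mollifier_le.
apply: (@integrable_periodizeM _ _ _ _ d (M / d)) => //.
- exact: measurable_mollifier.
- by move=> y; rewrite ger0_norm ?JM// mollifier_ge0.
- by move=> y; exact: mollifier_supp.
Qed.

Lemma mollifyE f x : measurable_fun (`[0, 1] : set K) f ->
  mollify J d f x = \int[mu]_z (periodize f z * mollifier J d (x - z)).
Proof.
move=> mf; congr fine.
rewrite -[RHS](@integral_reflect _ x); last first.
  apply/measurable_EFinP; apply: measurable_funM; first exact: measurable_periodize.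
  by apply: measurableT_comp; [exact: measurable_mollifier|exact: measurable_funB].
by apply: eq_integral => y _; rewrite subKr.
Qed.

(** [mollify] is the [fine] of an extended integral; undoing it takes finiteness, which a bounded
    kernel of bounded support provides. *)
Lemma ge0_mollifyE f x : mu.-integrable `[0, 1] (EFin \o f) -> (forall y, 0 <= f y) ->
  (mollify J d f x)%:E = (\int[mu]_y (periodize f (x - y) * mollifier J d y)%:E)%E.
Proof.
move=> itf f0; have mf := integrable_measurable_fun itf.
have -> : (\int[mu]_y (periodize f (x - y) * mollifier J d y)%:E =
    \int[mu]_z (periodize f z * mollifier J d (x - z))%:E)%E.
  rewrite -[RHS](@integral_reflect _ x).
    by apply: eq_integral => y _; rewrite subKr.
  have := integrable_mollify_integrand x itf.
  by move=> /integrable_measurable_fun/measurable_EFinP.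
by rewrite mollifyE// fineK//; apply: integrable_fin_num (integrable_mollify_integrand x itf).
Qed.

Lemma normr_mollify_le f x : mu.-integrable `[0, 1] (EFin \o f) ->
  `|mollify J d f x| <= mollify J d (fun y => `|f y|) x.
Proof.
move=> itf; have mf := integrable_measurable_fun itf.
rewrite !mollifyE//; last exact: measurableT_comp.
apply: le_trans (le_normr_Rintegral _ (integrable_mollify_integrand x itf)) _ => //.
rewrite le_eqVlt; apply/orP; left; apply/eqP; apply: eq_Rintegral => z _.
by rewrite normrM (ger0_norm (mollifier_ge0 _ d0)).
Qed.

Lemma mollify_sqr_le f x : mu.-integrable `[0, 1] (EFin \o f) ->
  mu.-integrable `[0, 1] (EFin \o (fun y => f y ^+ 2)) ->
  mollify J d f x ^+ 2 <= mollify J d (fun y => f y ^+ 2) x.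
Proof.
move=> itf itf2.
have mf := integrable_measurable_fun itf; have mf2 := integrable_measurable_fun itf2.
rewrite !mollifyE//.
set c := \int[mu]_z _.
have i1 := integrable_mollify_integrand x itf.
have i2 := integrable_mollify_integrand x itf2.
have i0 : mu.-integrable setT (EFin \o (fun z => mollifier J d (x - z))).
  have := integrable_mollify_integrand x (integrable_unit_cst 1).
  by apply: eq_integrable => // z _ /=; rewrite mul1r.
have I0 : \int[mu]_z mollifier J d (x - z) = 1.
  rewrite /Rintegral (@integral_reflect _ x (fun z => (mollifier J d z)%:E)).
    by rewrite integral_mollifier.
  by apply/measurable_EFinP; exact: measurable_mollifier.
(* Jensen: the integral of [(f - c)^2] against the kernel is nonnegative *)
have : 0 <= \int[mu]_z (periodize (fun y => f y ^+ 2) z * mollifier J d (x - z)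
   - (2 * c) * (periodize f z * mollifier J d (x - z)) + c ^+ 2 * mollifier J d (x - z)).
  apply: Rintegral_ge0 => z _.
  rewrite (_ : _ + _ = (periodize f z - c) ^+ 2 * mollifier J d (x - z)).
    by rewrite mulr_ge0 ?sqr_ge0 ?mollifier_ge0.
  by rewrite /periodize; ring.
rewrite RintegralD//; last 2 first.
- by apply: integrable_EFinB => //; exact: integrable_EFinZ.
- exact: integrable_EFinZ.
rewrite RintegralB//; last exact: integrable_EFinZ.
rewrite (RintegralZl _ _ i0)// (RintegralZl _ _ i1)// I0 -/c; nra.
Qed.

End Mollifier.

(** * Differentiating a mollified function *)

Section MollifyCalculus.
Context {K : realType}.
Local Notation mu := (@lebesgue_measure K).
Implicit Types (f g h phi : K -> K) (a b c x y z r M d : K).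
Variable J : K -> K.
Hypothesis hJ : standard_mollifier J.

Let m_smooth d : smooth (mollifier J d) := @mollifier_smooth K J hJ d.

Lemma mollifier_supported d : 0 < d -> supported_in (- d) d (mollifier J d).
Proof.
move=> d0 y yd; apply: (mollifier_supp hJ d0); rewrite ltNge; apply/negP.
by rewrite ler_norml => /andP[? ?]; case/orP: yd; lra.
Qed.

Lemma derive1_mollifier_le d : 0 < d ->
  exists2 M, 0 < M & forall y, `|derive1 (mollifier J d) y| <= M.
Proof.
move=> d0; have psupp' := supported_derive1 (mollifier_supported d0).
apply: (@continuous_support_bounded _ _ d); first exact: (smooth_continuous (n := 1) (@m_smooth d)).
move=> y yd; apply: psupp'; move: yd; rewrite ltr_normr => /orP[|] yd; apply/orP; [right|left] => //.
by rewrite ltrNr.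
Qed.

Lemma is_derive_mollify d f x : 0 < d -> mu.-integrable `[0, 1] (EFin \o f) ->
  is_derive x (1 : K) (mollify J d f)
    (\int[mu]_z (periodize f z * derive1 (mollifier J d) (x - z))).
Proof.
move=> d0 itf; have mf := integrable_measurable_fun itf.
pose F x z := periodize f z * mollifier J d (x - z).
have mE : mollify J d f = fun x => \int[mu]_z F x z.
  by apply/funext => y; rewrite mollifyE.
have dF y z : is_derive y (1 : K) (fun w => F w z)
    (periodize f z * derive1 (mollifier J d) (y - z)).
  have := @is_derive1_affine K (mollifier J d) 1 (- z) y (@m_smooth d 0 _).
  rewrite !mul1r => D.
  rewrite (_ : F^~ z = fun w => periodize f z * mollifier J d (1 * w - z)).
    exact: (@is_deriveZ _ _ _ _ (periodize f z)).
  by apply/funext => w; rewrite mul1r.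
have psupp' := supported_derive1 (mollifier_supported d0).
have [M M0 MP] := derive1_mollifier_le d0.
(* This interval contains [x' - d, x' + d] for every x' at distance less than 1 from [x], so off it
   the differentiated kernel vanishes for all these parameters at once. *)
pose S : set K := `[x - 1 - d, x + 1 + d]%classic.
pose G z := M * ((fun z => `|periodize f z|) \_ S) z.
have I x' : `]x - 1, x + 1[%classic x' -> mu.-integrable setT (EFin \o F x').
  by move=> _; exact: integrable_mollify_integrand.
have dI x' z : `]x - 1, x + 1[%classic x' -> setT z -> derivable (F^~ z) x' 1.
  by move=> _ _; have [] := dF x' z.
have G0 z : 0 <= G z.
  by rewrite mulr_ge0 ?(ltW M0)// /patch; case: ifPn => _.
have iG : mu.-integrable setT (EFin \o G).
  apply: integrable_EFinZ => //; rewrite -restrict_EFin.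
  apply/(integrable_mkcond _ _).1 => //.
    exact: measurable_itv.
  exact: (integrable_EFin_norm (integrable_periodize _ _ itf)).
have ub x' z : `]x - 1, x + 1[%classic x' -> setT z -> `|partial1of2 F x' z| <= G z.
  rewrite /= in_itv/= => /andP[x1 x2] _.
  rewrite partial1of2E; have [_ ->] := dF x' z.
  rewrite normrM mulrC /G /patch; case: ifPn => zS.
    by rewrite ler_wpM2r.
  rewrite psupp' ?normr0 ?mul0r ?mulr0//.
  move/negP: zS; rewrite inE /S/= in_itv/= => zS.
  have [|zd] := ltP (x' - z) (- d); first by [].
  by rewrite /= ltNge; apply/negP => zd'; apply: zS; apply/andP; split; lra.
have Ix : `]x - 1, x + 1[%classic x by rewrite /= in_itv/=; apply/andP; split; lra.
rewrite mE; apply: DeriveDef.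
  exact: (@derivable_under_integral _ _ _ mu F setT measurableT x (x - 1) (x + 1) Ix I dI G G0 iG ub).
rewrite -derive1E.
rewrite (@differentiation_under_integral _ _ _ mu F setT measurableT x (x - 1) (x + 1) Ix I dI G G0 iG ub).
by apply: eq_Rintegral => z _; rewrite partial1of2E; have [_ ->] := dF x z.
Qed.

Lemma continuous_mollify d f : 0 < d -> mu.-integrable `[0, 1] (EFin \o f) ->
  continuous (mollify J d f).
Proof.
move=> d0 itf x; apply/differentiable_continuous/derivable1_diffP.
by have [] := is_derive_mollify x d0 itf.
Qed.

Lemma measurable_mollify d f (D : set K) : 0 < d -> mu.-integrable `[0, 1] (EFin \o f) ->
  measurable_fun D (mollify J d f).
Proof.
move=> d0 itf; apply: (@measurable_funS _ _ _ _ setT) => //.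
by apply: continuous_measurable_fun; exact: continuous_mollify.
Qed.

Lemma derive1_mollify d f g x : 0 < d < 2^-1 -> weak_derivative f g ->
  derive1 (mollify J d f) x = mollify J d g x.
Proof.
move=> /andP[d0 d2] [itf itg fg].
have mf := integrable_measurable_fun itf; have mg := integrable_measurable_fun itg.
have two : 2^-1 + 2^-1 = 1 :> K by field.
rewrite derive1E; have [_ ->] := is_derive_mollify x d0 itf.
rewrite (mollifyE hJ)//.
pose phi z := mollifier J d (x - z).
have phiE : phi = fun z => 1 * mollifier J d (-1 * z + x).
  by apply/funext => z; rewrite mul1r mulN1r addrC.
have sphi : smooth phi by rewrite phiE; exact: smooth_affine.
have dphi z : derive1 phi z = - derive1 (mollifier J d) (x - z).
  have := @is_derive1_affine K (mollifier J d) (-1) x z (@m_smooth d 0 _).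
  rewrite !mulN1r (addrC _ x) => -[_ <-]; rewrite derive1E.
  by congr ('D_1 _ z); apply/funext => w; rewrite /phi mulN1r addrC.
have mphi : measurable_fun setT phi.
  by apply: continuous_measurable_fun; exact: (smooth_continuous (n := 0) sphi).
have mdphi : measurable_fun setT (derive1 phi).
  by apply: continuous_measurable_fun; exact: (smooth_continuous (n := 1) sphi).
(* The unit window is centred at [x], and [e] is the gap between its ends and the support
   [x - d, x + d] of [phi]; it is positive because d < 1/2. *)
pose a := x - 2^-1; pose e := 2^-1 - d.
have e0 : 0 < e by rewrite /e; lra.
have supp : supported_in (a + e) (a + 1 - e) phi.
  move=> z za; apply: (mollifier_supp hJ d0); rewrite ltr_normr.
  by case/orP: za => za; apply/orP; [left|right]; rewrite /a /e in za; lra.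
have dE : derive1 (repeat_from a phi) = repeat_from a (derive1 phi).
  by have [] := derive1n_repeat_from 1 e0 supp sphi.
have supp1 psi : supported_in (a + e) (a + 1 - e) psi -> supported_in a (a + 1) psi.
  by move=> s z za; apply: s; case/orP: za => za; apply/orP; [left|right]; lra.
have tt := torus_test_repeat_from e0 supp sphi.
have [M M0 MP] := derive1_mollifier_le d0.
have cdm : measurable_fun setT (derive1 (mollifier J d)).
  by apply: continuous_measurable_fun; exact: (smooth_continuous (n := 1) (@m_smooth d)).
have supp' := supported_derive1 (mollifier_supported d0).
have ip := @integrable_periodizeM K f _ x d M itf cdm MP.
(* The sign from differentiating in [z] instead of [x] cancels the one in the definition of the weak
   derivative. *)
have E : \int[mu]_z (periodize f z * derive1 phi z) =
    - \int[mu]_z (periodize f z * derive1 (mollifier J d) (x - z)).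
  rewrite -mulN1r -RintegralZl//.
    by apply: eq_Rintegral => z _; rewrite dphi mulN1r mulrN.
  apply: ip => y yd; apply: supp'; move: yd.
  by rewrite ltr_normr => /orP[|] yd; apply/orP; [right|left] => //; rewrite ltrNr.
have Rf := @Rintegral_periodize K f (derive1 phi) a mf mdphi (supp1 _ (supported_derive1 supp)).
have Rg := @Rintegral_periodize K g phi a mg mphi (supp1 _ supp).
by have := fg _ tt; rewrite dE -Rf -Rg E => /oppr_inj ->.
Qed.

End MollifyCalculus.

(** * Conservation of the integral and convergence at Lebesgue points *)

Section MollifyConvergence.
Context {K : realType}.
Local Notation mu := (@lebesgue_measure K).
Implicit Types (f g h phi : K -> K) (a b c x y z r M d : K).
Variable J : K -> K.
Hypothesis hJ : standard_mollifier J.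

(** By Tonelli one may integrate in x first: every translate of the periodic extension has the same
    integral over a period, and the kernel has mass 1. *)
Lemma integral_mollify d h : 0 < d -> mu.-integrable `[0, 1] (EFin \o h) ->
  (forall x, 0 <= h x) ->
  (\int[mu]_(x in `[0%R, 1%R]) (mollify J d h x)%:E = \int[mu]_(x in `[0%R, 1%R]) (h x)%:E)%E.
Proof.
move=> d0 ith h0; have mh := integrable_measurable_fun ith.
have mp := measurable_periodize mh.
pose I := `[0%R, 1%R]%classic : set K.
have mI : measurable I by exact: measurable_itv.
pose k (p : K * K) := (\1_I p.1 * (periodize h (p.1 - p.2) * mollifier J d p.2))%:E.
have mk : measurable_fun [set: (measurableTypeR K * measurableTypeR K)%type] k.
  apply/measurable_EFinP; apply: measurable_funM.
    have m1 : measurable_fun setT (\1_I : measurableTypeR K -> measurableTypeR K).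
      by apply: measurable_indic; exact: measurable_itv.
    exact: (measurableT_comp m1 measurable_fst).
  apply: measurable_funM.
    by apply: (measurableT_comp mp); exact: measurable_funB.
  by apply: (measurableT_comp (@measurable_mollifier K J hJ d)).
have k0 p : (0 <= k p)%E.
  by rewrite lee_fin mulr_ge0// mulr_ge0 ?mollifier_ge0//; exact: h0.
have k1 (u : K -> K) : (\int[mu]_(x in I) (u x)%:E = \int[mu]_x (\1_I x * u x)%:E)%E.
  rewrite integral_mkcond; apply: eq_integral => x _.
  rewrite /patch indicE; case: ifPn => // _; first by rewrite mul1r.
  by rewrite mul0r.
transitivity (\int[mu]_x \int[mu]_y k (x, y))%E.
  rewrite integral_mkcond; apply: eq_integral => x _.
  rewrite /patch /k/= indicE; case: ifPn => /= _.
    by rewrite (ge0_mollifyE hJ)//; apply: eq_integral => y _; rewrite mul1r.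
  by rewrite integral0_eq// => y _; rewrite mul0r.
rewrite (@fubini_tonelli _ _ _ _ _ mu mu k mk k0).
have inner y : (\int[mu]_x k (x, y) = (mollifier J d y)%:E * \int[mu]_(x in I) (h x)%:E)%E.
  have -> : (\int[mu]_x k (x, y) = \int[mu]_(x in I) ((mollifier J d y)%:E * (periodize h (x - y))%:E))%E.
    transitivity (\int[mu]_(x in I) (periodize h (x - y) * mollifier J d y)%:E)%E.
      by rewrite k1.
    by apply: eq_integral => x _; rewrite -EFinM mulrC.
  rewrite ge0_integralZl_EFin//; last 3 first.
  - by move=> x _; rewrite lee_fin; exact: h0.
  - apply/measurable_EFinP; apply: (measurable_funS (E := setT)) => //.
    by apply: measurableT_comp => //; exact: measurable_funB.
  - exact: mollifier_ge0.
  congr (_ * _)%E; rewrite -(@ge0_integral_periodize _ h (- y))//.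
  rewrite (@ge0_integral_shift _ (- y))//; last 2 first.
  - by apply/measurable_EFinP; apply: measurable_funS mp.
  - by move=> x _; rewrite lee_fin; exact: h0.
  congr (integral _ _ _); apply/seteqP; split => x; rewrite /I/= !in_itv/= => /andP[? ?];
    apply/andP; split; lra.
under eq_integral do rewrite inner.
rewrite ge0_integralZr//; last 3 first.
- by apply/measurable_EFinP; exact: measurable_mollifier.
- by move=> y _; rewrite lee_fin mollifier_ge0.
- by apply: integral_ge0 => x _; rewrite lee_fin.
by rewrite (integral_mollifier hJ)// mul1e.
Qed.

Lemma locally_integrable_periodize f : mu.-integrable `[0, 1] (EFin \o f) ->
  locally_integrable setT (periodize f).
Proof.
move=> itf; split; [by apply: measurable_periodize; exact: integrable_measurable_fun itf|exact: openT|].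
move=> C _ cC; have [N [_ NP]] := compact_bounded cC.
have sub : C `<=` `[- (N + 1), N + 1]%classic.
  by move=> x Cx; rewrite /= in_itv/= -ler_norml; apply: (NP (N + 1)) => //; rewrite ltrDl.
have /integrableP[m] := integrable_periodize (- (N + 1)) (N + 1) itf.
apply: le_lt_trans; apply: ge0_subset_integral => //.
  exact: compact_measurable.
by do 2 apply: measurableT_comp => //; exact/measurable_EFinP.
Qed.

(** The kernel is at most M/d and reaches no further than [d], so the error is bounded by a multiple
    of the mean of |f - f(x)| over a ball around [x], which vanishes at Lebesgue points of the
    periodic extension. *)
Lemma ae_mollify_cvg f : mu.-integrable `[0, 1] (EFin \o f) ->
  {ae mu, forall x, `[0, 1]%classic x -> mollify J d f x @[d --> 0^'+] --> f x}.
Proof.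
move=> itf; have mf := integrable_measurable_fun itf.
have mp := measurable_periodize mf.
have [M M0 JM] := mollifier_le hJ.
(* At 1 the extension equals [f 0], which is unrelated to [f 1]. *)
have ae1 : {ae mu, forall x, x != 1}.
  exists [set 1]; split; [exact: measurable_set1|exact: lebesgue_measure_set1|].
  by move=> x /= /negP; rewrite negbK => /eqP.
have leb := lebesgue_differentiation (locally_integrable_periodize itf).
apply: ae_imp2 leb ae1 => x lx xn1; rewrite /= in_itv/= => /andP[x0 x1].
have fx : periodize f x = f x by rewrite periodize_id// x0 lt_neqAle xn1.
have key d : 0 < d -> (`|mollify J d f x - f x|%:E <= (4 * M)%:E * davg (periodize f) x (2 * d))%E.
  move=> d0.
  have i1 := integrable_mollify_integrand hJ d0 x itf.
  have i2 := integrable_mollify_integrand hJ d0 x (integrable_unit_cst (f x)).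
  have -> : mollify J d f x - f x =
      \int[mu]_z (periodize f z * mollifier J d (x - z) - f x * mollifier J d (x - z)).
    rewrite RintegralB// (mollifyE hJ)//; congr (_ - _).
    rewrite RintegralZl//; last first.
      have := integrable_mollify_integrand hJ d0 x (integrable_unit_cst 1).
      by apply: eq_integrable => // z _ /=; rewrite mul1r.
    rewrite /Rintegral (@integral_reflect _ x (fun z => (mollifier J d z)%:E)).
      by rewrite (integral_mollifier hJ)//= mulr1.
    by apply/measurable_EFinP; exact: measurable_mollifier.
  rewrite EFin_normr_Rintegral//; last exact: integrable_EFinB.
  have mi (D : set K) : measurable_fun D
      (fun z => (periodize f z * mollifier J d (x - z) - f x * mollifier J d (x - z))%:E).
    have /integrable_measurable_fun := integrable_EFinB measurableT i1 i2.
    by move=> m; apply/measurable_EFinP; exact: measurable_funS m.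
  have lai := le_abse_integral mu measurableT (mi setT).
  apply: (le_trans lai).
  have mb : measurable (ball x (2 * d)) by exact: measurable_ball.
  have mc : measurable_fun setT (fun z => `|periodize f z - f x|).
    by apply: measurableT_comp => //; exact: measurable_funB.
  (* Balls are open while the support |x - z| <= d is closed, hence the radius 2d. The ball has
     length 4d, which turns the kernel bound M/d into the factor 4M in front of the mean. *)
  apply: (@le_trans _ _ (\int[mu]_(z in ball x (2 * d)) ((M / d)%:E * `|periodize f z - f x|%:E))%E).
    rewrite [leRHS]integral_mkcond; apply: ge0_le_integral_lower => // z _.
    rewrite /patch -mulrBl; case: ifPn => zb.
      rewrite -EFinM lee_fin normrM mulrC ler_wpM2r//.
      by rewrite ger0_norm ?JM// (mollifier_ge0 hJ).
    rewrite (mollifier_supp hJ d0) ?mulr0 ?abse0//.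
    rewrite ltNge; apply/negP => xz; move/negP: zb; apply; rewrite inE.
    by rewrite /ball/=; apply: (le_lt_trans xz); rewrite ltr_pMl// ltr1n.
  rewrite ge0_integralZl_EFin//; last 2 first.
  - by apply/measurable_EFinP; exact: measurable_funS mc.
  - by rewrite divr_ge0// ltW.
  rewrite /davg /iavg lebesgue_measure_ball; last by rewrite mulr_ge0// ltW.
  rewrite muleA inver mulrn_eq0/= gt_eqF ?mulr_gt0// -EFinM.
  have -> : 4 * M * (2 * d *+ 2)^-1 = M / d.
    by field; rewrite gt_eqF.
  apply: lee_pmul => //; [by rewrite lee_fin divr_ge0// ltW|exact: integral_ge0|].
  rewrite le_eqVlt; apply/orP; left; apply/eqP.
  by apply: eq_integral => z _; rewrite /= fx.
apply/cvgrPdist_le => e e0.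
have e1 : 0 < e / (4 * M) by rewrite divr_gt0// mulr_gt0.
have : \forall r \near 0^'+, (davg (periodize f) x r < (e / (4 * M))%:E)%E.
  move/fine_cvgP : lx => [lfin l0].
  near=> r; rewrite -[X in (X < _)%E]fineK; last by near: r.
  by rewrite lte_fin; near: r; exact: (cvgr_lt 0).
move=> [s /= s0 sP].
near=> d.
have d0 : 0 < d by [].
have := key d d0.
have : (davg (periodize f) x (2 * d) < (e / (4 * M))%:E)%E.
  apply: sP; last by rewrite mulr_gt0.
  rewrite /= sub0r normrN gtr0_norm ?mulr_gt0// mulrC -ltr_pdivlMr//.
  near: d; apply: nbhs_right_lt; by rewrite divr_gt0.
move=> /ltW lt1 le1; rewrite distrC -lee_fin; apply: (le_trans le1).
apply: (@le_trans _ _ ((4 * M)%:E * (e / (4 * M))%:E)%E).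
  by apply: lee_wpmul2l => //; rewrite lee_fin mulr_ge0// ltW.
by rewrite -EFinM mulrC divfK// gt_eqF// mulr_gt0.
Unshelve. all: by end_near. Qed.

End MollifyConvergence.

(** * Convergence in L^1 and the commutator estimate *)

Section MollifyEstimates.
Context {K : realType}.
Local Notation mu := (@lebesgue_measure K).
Implicit Types (f g h q : K -> K) (x y z d A : K).
Variable J : K -> K.
Hypothesis hJ : standard_mollifier J.

Lemma mollifyD d f g x : 0 < d -> mu.-integrable `[0, 1] (EFin \o f) ->
  mu.-integrable `[0, 1] (EFin \o g) ->
  mollify J d (fun y => f y + g y) x = mollify J d f x + mollify J d g x.
Proof.
move=> d0 itf itg.
have mf := integrable_measurable_fun itf; have mg := integrable_measurable_fun itg.
rewrite !(mollifyE hJ)//; last exact: measurable_funD.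
rewrite -(@RintegralD _ _ _ mu setT _ _ measurableT (integrable_mollify_integrand hJ d0 x itf)
  (integrable_mollify_integrand hJ d0 x itg)).
by apply: eq_Rintegral => z _; rewrite -mulrDl.
Qed.

Lemma mollifyZ d k f x : 0 < d -> mu.-integrable `[0, 1] (EFin \o f) ->
  mollify J d (fun y => k * f y) x = k * mollify J d f x.
Proof.
move=> d0 itf; have mf := integrable_measurable_fun itf.
rewrite !(mollifyE hJ)//; last exact: measurable_funM.
rewrite -(@RintegralZl _ _ _ mu setT _ k measurableT (integrable_mollify_integrand hJ d0 x itf)).
by apply: eq_Rintegral => z _; rewrite /periodize mulrA.
Qed.

Lemma mollify_ge0 d f x : 0 < d -> (forall y, 0 <= f y) -> 0 <= mollify J d f x.
Proof.
by move=> d0 f0; apply: Rintegral_ge0 => y _; rewrite mulr_ge0 ?(mollifier_ge0 hJ)//; exact: f0.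
Qed.

Lemma ae_mollify_cvg_seq f (dn : nat -> K) : mu.-integrable `[0, 1] (EFin \o f) ->
  (forall n, 0 < dn n) -> dn @ \oo --> 0 ->
  {ae mu, forall x, `[0, 1]%classic x -> mollify J (dn n) f x @[n --> \oo] --> f x}.
Proof.
move=> itf dn0 dnc; apply: ae_imp (ae_mollify_cvg hJ itf) => x xP x01.
by have /cvg_at_rightP := xP x01; apply.
Qed.

(** The dominator is the mollification of |f| plus |f|; its integral is twice that of |f| for every
    index. *)
Lemma mollify_L1_cvg f (dn : nat -> K) : mu.-integrable `[0, 1] (EFin \o f) ->
  (forall n, 0 < dn n) -> dn @ \oo --> 0 ->
  (\int[mu]_(x in `[0%R, 1%R]) (`|mollify J (dn n) f x - f x|)%:E @[n --> \oo] --> 0)%E.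
Proof.
move=> itf dn0 dnc; have mf := integrable_measurable_fun itf.
have itn : mu.-integrable `[0, 1] (EFin \o (fun x => `|f x|)).
  exact: (integrable_EFin_norm itf).
have mI : measurable (`[0%R, 1%R]%classic : set (measurableTypeR K)) by [].
pose G x := `|f x| + `|f x|.
have itG : mu.-integrable `[0, 1] (EFin \o G) by exact: integrable_EFinD.
have G0 x : 0 <= G x by rewrite addr_ge0.
apply: (@lower_pratt _ _ _ mu _ _
  (fun n x => (mollify J (dn n) (fun y => `|f y|) x + `|f x|)%:E) (fun x => (G x)%:E)) => //.
- move=> n; apply/measurable_EFinP; apply: measurable_funD; last exact: measurableT_comp.
  exact: measurable_mollify.
- by move=> n x _; rewrite lee_fin addr_ge0// mollify_ge0.
- by case/integrableP : itG.
- by move=> x _; rewrite lee_fin.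
- move=> n; have itm : mu.-integrable `[0, 1] (EFin \o mollify J (dn n) (fun y => `|f y|)).
    apply/integrableP; split; first by apply/measurable_EFinP; exact: measurable_mollify.
    under eq_integral => x _ do rewrite /= ger0_norm ?mollify_ge0//.
    rewrite (integral_mollify hJ)//; have /integrableP[_ ltn] := itf; exact: ltn.
  rewrite (@integralD_EFin _ _ _ mu _ mI (mollify J (dn n) (fun y => `|f y|)) (fun x => `|f x|) itm itn).
  by rewrite (integral_mollify hJ)// -(@integralD_EFin _ _ _ mu _ mI _ _ itn itn).
- exact: (integrable_lty mI itG).
- apply: aeW => x n _; rewrite lee_fin (le_trans (ler_normB _ _))// lerD2r.
  exact: normr_mollify_le.
- apply: ae_imp (ae_mollify_cvg_seq itf dn0 dnc) => x xP /xP xc.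
  apply/fine_cvgP; split; first exact: nearW.
  rewrite (_ : 0 = `|f x - f x|); last by rewrite subrr normr0.
  by apply: cvg_norm; apply: cvgB => //; exact: cvg_cst.
- apply: ae_imp (ae_mollify_cvg_seq itn dn0 dnc) => x xP /xP xc.
  apply/fine_cvgP; split; first exact: nearW.
  by apply: cvgD => //; exact: cvg_cst.
Qed.

Lemma mollify_commutator A q (b : K -> K) (a : nat -> K -> K) (dn : nat -> K) :
  mu.-integrable `[0, 1] (EFin \o q) ->
  mu.-integrable `[0, 1] (EFin \o (fun x => q x ^+ 2)) ->
  measurable_fun (`[0, 1] : set K) b ->
  {ae mu, forall x, `[0, 1]%classic x -> `|b x| <= A} ->
  {ae mu, forall x n, `[0, 1]%classic x -> `|a n x| <= A} ->
  {ae mu, forall x, `[0, 1]%classic x -> a n x @[n --> \oo] --> b x} ->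
  (forall n, 0 < dn n) -> dn @ \oo --> 0 ->
  let E n x := (`|a n x * mollify J (dn n) q x - mollify J (dn n) (fun y => b y * q y) x| ^+ 2)%:E in
  (forall n, \int[mu]_(x in `[0%R, 1%R]) E n x <=
     (4 * A ^+ 2)%:E * \int[mu]_(x in `[0%R, 1%R]) (q x ^+ 2)%:E)%E /\
  (\int[mu]_(x in `[0%R, 1%R]) E n x @[n --> \oo] --> 0)%E.
Proof.
move=> itq itq2 mb bA aA ab dn0 dnc E.
have mq := integrable_measurable_fun itq; have mq2 := integrable_measurable_fun itq2.
have mI : measurable (`[0%R, 1%R]%classic : set (measurableTypeR K)) by [].
have mbq : measurable_fun (`[0, 1] : set K) (fun x => b x * q x) by exact: measurable_funM.
have itbq : mu.-integrable `[0, 1] (EFin \o (fun x => b x * q x)).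
  apply/integrableP; split; first exact/measurable_EFinP.
  have itAq := integrable_EFinZ mI A (integrable_EFin_norm itq).
  have /integrableP[mAq] := itAq.
  apply: le_lt_trans; apply: ae_ge0_le_integral_lower => //.
    by apply: (measurableT_comp _ mAq); exact: abse_measurable.
  apply: ae_imp bA => x xP x01; rewrite lee_fin !normrM normr_id ler_wpM2r//.
  exact: le_trans (xP x01) (ler_norm _).
have mbq2 : measurable_fun (`[0, 1] : set K) (fun x => (b x * q x) ^+ 2).
  exact: measurable_funX.
have bq2 : {ae mu, forall x, `[0, 1]%classic x -> (b x * q x) ^+ 2 <= A ^+ 2 * q x ^+ 2}.
  apply: ae_imp bA => x xP /xP bx; rewrite exprMn ler_wpM2r ?sqr_ge0//.
  rewrite -[leLHS]real_normK ?num_real// lerXn2r ?nnegrE//.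
  exact: le_trans (normr_ge0 _) bx.
have itbq2 : mu.-integrable `[0, 1] (EFin \o (fun x => (b x * q x) ^+ 2)).
  apply/integrableP; split; first exact/measurable_EFinP.
  have /integrableP[mAq] := integrable_EFinZ mI (A ^+ 2) itq2.
  apply: le_lt_trans; apply: ae_ge0_le_integral_lower => //.
    by apply: (measurableT_comp _ mAq); exact: abse_measurable.
  apply: ae_imp bq2 => x xP x01; rewrite lee_fin.
  by rewrite ger0_norm ?sqr_ge0// ger0_norm ?xP// mulr_ge0 ?sqr_ge0.
(* This comes from (s - t)^2 <= 2 s^2 + 2 t^2, with Jensen applied to each term after mollification.
   As |b| <= A almost everywhere, [P] is at most 4 A^2 q^2. *)
pose P x := 2 * A ^+ 2 * q x ^+ 2 + 2 * (b x * q x) ^+ 2.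
have itP : mu.-integrable `[0, 1] (EFin \o P).
  by apply: integrable_EFinD => //; apply: integrable_EFinZ.
have P0 x : 0 <= P x.
  by rewrite /P addr_ge0// mulr_ge0 ?sqr_ge0// mulr_ge0 ?sqr_ge0.
have EP : {ae mu, forall x n, `[0, 1]%classic x -> (E n x <= (mollify J (dn n) P x)%:E)%E}.
  apply: ae_imp aA => x xP n x01; rewrite lee_fin.
  have ax := xP n x01.
  rewrite /P mollifyD//; last 2 first.
  - exact: integrable_EFinZ.
  - exact: integrable_EFinZ.
  rewrite !mollifyZ//.
  have h1 := mollify_sqr_le hJ (dn0 n) x itq itq2.
  have h2 := mollify_sqr_le hJ (dn0 n) x itbq itbq2.
  have A0 : 0 <= A by exact: le_trans (normr_ge0 _) ax.
  have h3 : (a n x * mollify J (dn n) q x) ^+ 2 <= A ^+ 2 * mollify J (dn n) (fun y => q y ^+ 2) x.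
    rewrite exprMn; apply: ler_pM; rewrite ?sqr_ge0//.
    by rewrite -[leLHS]real_normK ?num_real// lerXn2r ?nnegrE.
  rewrite real_normK ?num_real//.
  move: h2 h3; set s := mollify _ _ _ _; set t := a n x * _.
  set t2 := mollify _ _ _ _; set t3 := _ * mollify _ _ _ _ => h2 h3.
  rewrite -mulrA -/t3.
  have := sqr_ge0 (t + s); rewrite sqrrD sqrrB; lra.
have mP n : measurable_fun (`[0%R, 1%R] : set K) (mollify J (dn n) P) by exact: measurable_mollify.
have mPE n : measurable_fun (`[0%R, 1%R] : set K) (fun x => (mollify J (dn n) P x)%:E).
  exact/measurable_EFinP.
have E0 n x : (0 <= E n x)%E by rewrite lee_fin sqr_ge0.
split.
  move=> n.
  apply: (@le_trans _ _ (\int[mu]_(x in `[0%R, 1%R]) (mollify J (dn n) P x)%:E)%E).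
    apply: ae_ge0_le_integral_lower => //.
      by move=> x _; rewrite lee_fin mollify_ge0.
      exact: mPE.
    by apply: (ae_imp _ EP) => x xP x01; exact: xP.
  rewrite (integral_mollify hJ)//.
  rewrite -(@ge0_integralZl_EFin _ _ _ mu _ mI (fun x => (q x ^+ 2)%:E) _ _ (4 * A ^+ 2)); last 3 first.
  - by move=> x _; rewrite lee_fin sqr_ge0.
  - exact/measurable_EFinP.
  - by rewrite mulr_ge0// sqr_ge0.
  apply: ae_ge0_le_integral_lower => //.
  - by move=> x _; rewrite lee_fin.
  - by move=> x _; rewrite -EFinM lee_fin mulr_ge0 ?sqr_ge0// mulr_ge0 ?sqr_ge0.
  - by apply/measurable_EFinP; exact: measurable_funM.
  - apply: ae_imp bq2 => x xP /xP h; rewrite -EFinM lee_fin /P; lra.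
apply: (@lower_pratt _ _ _ mu _ _ (fun n x => (mollify J (dn n) P x)%:E) (fun x => (P x)%:E)) => //.
- by move=> n x _; rewrite lee_fin mollify_ge0.
- by case/integrableP : itP.
- by move=> x _; rewrite lee_fin.
- by move=> n; rewrite (integral_mollify hJ).
- exact: (integrable_lty mI itP).
- have := ae_imp2 _ (ae_mollify_cvg_seq itq dn0 dnc) (ae_mollify_cvg_seq itbq dn0 dnc).
  move=> /(_ (fun x => `[0, 1]%classic x -> mollify J (dn n) q x @[n --> \oo] --> q x /\
    mollify J (dn n) (fun y => b y * q y) x @[n --> \oo] --> b x * q x)).
  move=> /(_ (fun x p1 p2 x01 => conj (p1 x01) (p2 x01))).
  apply: ae_imp2 ab => x abx xP x01; have [c1 c2] := xP x01.
  apply/fine_cvgP; split; first exact: nearW.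
  pose e n := `|a n x * mollify J (dn n) q x - mollify J (dn n) (fun y => b y * q y) x|.
  have h : e @ \oo --> (0 : K).
    rewrite (_ : 0 = `|b x * q x - b x * q x|); last by rewrite subrr normr0.
    by apply: cvg_norm; apply: cvgB => //; apply: cvgM => //; exact: abx.
  rewrite (_ : _ \o _ = fun n => e n * e n); last by apply/funext => n; rewrite /= expr2.
  by rewrite -[X in _ --> X](mulr0 0); exact: cvgM.
- apply: ae_imp (ae_mollify_cvg_seq itP dn0 dnc) => x xP /xP xc.
  by apply/fine_cvgP; split; [exact: nearW|exact: xc].
Qed.

End MollifyEstimates.

(** * Sup bounds and uniqueness for weak derivatives *)

Section WeakDerivative.
Context {K : realType}.
Local Notation mu := (@lebesgue_measure K).
Implicit Types (f g h q : K -> K) (x y z d A : K).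
Variable J : K -> K.
Hypothesis hJ : standard_mollifier J.

Definition L1norm f : K := \int[mu]_(x in `[0, 1]) `|f x|.

Lemma L1normE f : mu.-integrable `[0, 1] (EFin \o f) ->
  (L1norm f)%:E = (\int[mu]_(x in `[0%R, 1%R]) `|f x|%:E)%E.
Proof.
move=> itf; rewrite /L1norm /Rintegral fineK//.
have itn : mu.-integrable `[0, 1] (EFin \o (fun x => `|f x|)) by exact: (integrable_EFin_norm itf).
exact: (integrable_fin_num _ itn).
Qed.

Lemma L1norm_ge0 f : 0 <= L1norm f.
Proof. exact: Rintegral_ge0. Qed.

Lemma integral_unit_cst (r : K) : (\int[mu]_(x in `[0%R, 1%R]) r%:E = r%:E)%E.
Proof. by rewrite integral_cst// [X in (_ * X)%E]lebesgue_measure_unit_itv mule1. Qed.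

(** Cauchy-Schwarz on a space of mass 1, obtained by integrating 2 c |f| <= f^2 + c^2 with [c] the
    L^1 norm itself. *)
Lemma sqr_L1norm_le f : mu.-integrable `[0, 1] (EFin \o f) ->
  mu.-integrable `[0, 1] (EFin \o (fun x => f x ^+ 2)) ->
  ((L1norm f ^+ 2)%:E <= \int[mu]_(x in `[0%R, 1%R]) (f x ^+ 2)%:E)%E.
Proof.
move=> itf itf2.
have mI : measurable (`[0%R, 1%R]%classic : set (measurableTypeR K)) by [].
have itn : mu.-integrable `[0, 1] (EFin \o (fun x => `|f x|)) by exact: (integrable_EFin_norm itf).
set c := L1norm f.
have c0 : 0 <= c by exact: L1norm_ge0.
have h : 2 * c * c <= \int[mu]_(x in `[0, 1]) (f x ^+ 2 + c ^+ 2).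
  rewrite {2}/c /L1norm -(@RintegralZl _ _ _ mu _ _ (2 * c) mI itn).
  apply: le_Rintegral => //.
  - exact: (integrable_EFinZ mI (2 * c) itn).
  - exact: (integrable_EFinD mI itf2 (integrable_unit_cst (c ^+ 2))).
  - move=> x _; have := sqr_ge0 (`|f x| - c).
    by rewrite sqrrB real_normK ?num_real//; lra.
move: h; rewrite (@RintegralD _ _ _ mu _ _ (fun=> c ^+ 2) mI itf2 (integrable_unit_cst (c ^+ 2))).
rewrite [X in _ + X](_ : _ = c ^+ 2); last first.
  by rewrite /Rintegral integral_unit_cst.
move=> h; rewrite -[leRHS]fineK; last exact: (integrable_fin_num mI itf2).
by rewrite lee_fin; move: h; rewrite /Rintegral; nra.
Qed.

Lemma integral_normr_mollify_le d f : 0 < d -> mu.-integrable `[0, 1] (EFin \o f) ->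
  (\int[mu]_(x in `[0%R, 1%R]) `|mollify J d f x|%:E <= (L1norm f)%:E)%E.
Proof.
move=> d0 itf; rewrite L1normE//.
have itn : mu.-integrable `[0, 1] (EFin \o (fun x => `|f x|)) by exact: (integrable_EFin_norm itf).
rewrite -(integral_mollify hJ d0 itn)//; apply: ge0_le_integral_lower => // x _.
by rewrite lee_fin normr_mollify_le.
Qed.

(** The mollification of [f] has derivative the mollification of [g], whose L^1 norm is at most that
    of [g]; the fundamental theorem of calculus does the rest. *)
Lemma mollify_dist d f g x y : 0 < d < 2^-1 -> weak_derivative f g ->
  0 <= x <= 1 -> 0 <= y <= 1 -> `|mollify J d f x - mollify J d f y| <= L1norm g.
Proof.
move=> dd fg; have [itf itg _] := fg; have /andP[d0 _] := dd.
wlog xy : x y / x < y => [H x01 y01|].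
  have [xy|yx|->] := ltgtP x y; first exact: H.
  - by rewrite distrC; exact: H.
  - by rewrite subrr normr0 L1norm_ge0.
move=> /andP[x0 x1] /andP[y0 y1].
have cg := continuous_mollify hJ d0 itg.
have FTC : (\int[mu]_(z in `[x, y]) (mollify J d g z)%:E =
    (mollify J d f y)%:E - (mollify J d f x)%:E)%E.
  apply: continuous_FTC2 => //.
  - exact: continuous_subspaceT.
  - split.
    + by move=> z _; have [] := is_derive_mollify hJ z d0 itf.
    + by apply: cvg_at_right_filter; exact: continuous_mollify.
    + by apply: cvg_at_left_filter; exact: continuous_mollify.
  - by move=> z _; rewrite (derive1_mollify hJ z dd fg).
rewrite distrC -lee_fin; apply: le_trans (integral_normr_mollify_le d0 itg).
rewrite -[leLHS]/(`|(mollify J d f y)%:E - (mollify J d f x)%:E|%E) -FTC.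
have mm (D : set K) : measurable_fun D (mollify J d g) by exact: measurable_mollify.
have mI : measurable (`[x, y]%classic : set (measurableTypeR K)) by [].
have me : measurable_fun (`[x, y]%classic : set (measurableTypeR K)) (fun z => (mollify J d g z)%:E).
  by apply/measurable_EFinP; exact: mm.
apply: (le_trans (le_abse_integral mu mI me)).
apply: ge0_subset_integral => //.
  apply/measurable_EFinP; apply: measurableT_comp => //; exact: mm.
by move=> z /=; rewrite !in_itv/= => /andP[? ?]; apply/andP; split; lra.
Qed.

(** A one-dimensional Sobolev inequality: the value at [x] exceeds the value at any [y] by at most
    the L^1 norm of [g], and this is averaged over [y]. *)
Lemma normr_mollify_sup d f g x : 0 < d < 2^-1 -> weak_derivative f g ->
  0 <= x <= 1 -> `|mollify J d f x| <= L1norm f + L1norm g.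
Proof.
move=> dd fg x01; have [itf itg _] := fg; have /andP[d0 _] := dd.
have mm (D : set K) : measurable_fun D (mollify J d f) by exact: measurable_mollify.
rewrite -lee_fin -(integral_unit_cst `|mollify J d f x|).
apply: (@le_trans _ _ (\int[mu]_(y in `[0%R, 1%R]) (`|mollify J d f y|%:E + (L1norm g)%:E))%E).
  apply: ge0_le_integral_lower => // y; rewrite /= in_itv/= => y01.
  rewrite -EFinD lee_fin -lerBlDl; apply: le_trans (mollify_dist dd fg x01 y01).
  exact: lerB_dist.
rewrite ge0_integralD//; last by move=> y _; rewrite lee_fin L1norm_ge0.
  2: by apply/measurable_EFinP; apply: measurableT_comp => //; exact: mm.
rewrite integral_unit_cst EFinD; apply: leeD => //; exact: integral_normr_mollify_le.
Qed.

Lemma mollify_seq_exists : exists dn : nat -> K,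
  (forall n, 0 < dn n < 2^-1) /\ dn @ \oo --> 0.
Proof.
(* Starting at 1/3 keeps every term strictly below 1/2. *)
exists (fun n => n.+3%:R^-1); split.
  by move=> n; rewrite invr_gt0 ltr0n/= ltf_pV2 ?posrE ?ltr0n// ltr_nat.
have := @cvg_harmonic K; rewrite -(cvg_shiftn 2).
by under eq_fun do rewrite /harmonic addn2.
Qed.

Lemma ae_weak_derivative_sup f g : weak_derivative f g ->
  {ae mu, forall x, `[0, 1]%classic x -> `|f x| <= L1norm f + L1norm g}.
Proof.
move=> fg; have [itf itg _] := fg.
have [dn [dn0 dnc]] := mollify_seq_exists.
have dnp n : 0 < dn n by have /andP[] := dn0 n.
apply: ae_imp (ae_mollify_cvg_seq hJ itf dnp dnc) => x xP x01.
have xc : `|mollify J (dn n) f x| @[n --> \oo] --> `|f x|.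
  by apply: cvg_norm; exact: xP.
rewrite -(cvg_lim _ xc)//; apply: limr_le; first by apply/cvg_ex; eexists; exact: xc.
apply: nearW => n; apply: (normr_mollify_sup (dn0 n) fg).
by move: x01; rewrite /= in_itv.
Qed.

(** The mollifications of [g] and [h] both equal the derivative of that of [f], and they converge
    almost everywhere to [g] and [h]. *)
Lemma weak_derivative_unique f g h : weak_derivative f g -> weak_derivative f h ->
  {ae mu, forall x, `[0, 1]%classic x -> g x = h x}.
Proof.
move=> fg fh; have [_ itg _] := fg; have [_ ith _] := fh.
have [dn [dn0 dnc]] := mollify_seq_exists.
have dnp n : 0 < dn n by have /andP[] := dn0 n.
apply: ae_imp2 (ae_mollify_cvg_seq hJ itg dnp dnc) (ae_mollify_cvg_seq hJ ith dnp dnc) => x xg xh x01.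
have cg := xg x01; have ch := xh x01.
rewrite -(cvg_lim _ cg)// -(cvg_lim _ ch)//; congr (lim (_ @ \oo)).
by apply/funext => n; rewrite -(derive1_mollify hJ x (dn0 n) fg) (derive1_mollify hJ x (dn0 n) fh).
Qed.

End WeakDerivative.

(** * The inverse derivative on the torus *)

Section Dxinv.
Context {K : realType}.
Local Notation mu := (@lebesgue_measure K).
Implicit Types (f g : K -> K) (x y : K).

Let A f x : K := \int[mu]_(y in `[0, x]) f y.

Let integrable_sub f x : mu.-integrable `[0, 1] (EFin \o f) -> x <= 1 ->
  mu.-integrable `[0, x] (EFin \o f).
Proof.
move=> itf x1; apply: integrableS itf => // y /=; rewrite !in_itv/= => /andP[-> yx].
exact: le_trans yx x1.
Qed.

Lemma continuous_primitive f : mu.-integrable `[0, 1] (EFin \o f) ->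
  {within `[0, 1], continuous (fun x => \int[mu]_(y in `[0, x]) f y)}.
Proof. by move=> itf; exact: parameterized_integral_continuous. Qed.

(** The primitive with its linear drift removed, so that it takes the same value at 0 and 1;
    [dxinv f] is [B f] minus its mean. *)
Let B f x := A f x - x * A f 1.

Let continuous_B f : mu.-integrable `[0, 1] (EFin \o f) ->
  {within `[0, 1], continuous (B f)}.
Proof.
move=> itf x; apply: continuousB; first exact: continuous_primitive.
have idc : {within `[0, 1], continuous (fun y : K => y)}.
  by apply: continuous_subspaceT => y; exact: cvg_id.
by apply: continuousM; [exact: idc|exact: cst_continuous].
Qed.

Let integrable_B f : mu.-integrable `[0, 1] (EFin \o f) ->
  mu.-integrable `[0, 1] (EFin \o B f).
Proof.
move=> itf; apply: continuous_compact_integrable; first exact: segment_compact.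
exact: continuous_B.
Qed.

Lemma continuous_dxinv f : mu.-integrable `[0, 1] (EFin \o f) ->
  {within `[0, 1], continuous (dxinv f)}.
Proof.
move=> itf x; apply: (@continuousB _ _ _ (B f : subspace _ -> _)); first exact: continuous_B.
exact: cst_continuous.
Qed.

Let A_sub f g x : mu.-integrable `[0, 1] (EFin \o f) ->
  mu.-integrable `[0, 1] (EFin \o g) -> 0 <= x <= 1 ->
  `|A f x - A g x| <= L1norm (fun y => f y - g y).
Proof.
move=> itf itg /andP[x0 x1].
have itx := integrable_sub itf x1; have itgx := integrable_sub itg x1.
have mI : measurable (`[0%R, x]%classic : set (measurableTypeR K)) by [].
have m1 : measurable (`[0%R, 1%R]%classic : set (measurableTypeR K)) by [].
rewrite /A -(@RintegralB _ _ _ mu _ _ _ mI itx itgx).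
have itfg := integrable_EFinB mI itx itgx.
have itfg1 := integrable_EFinB m1 itf itg.
rewrite -lee_fin (L1normE itfg1) (EFin_normr_Rintegral mI itfg).
have /integrableP[mfg _] := itfg.
apply: (le_trans (le_abse_integral mu mI mfg)).
apply: ge0_subset_integral => //.
  by have /integrableP[mfg1 _] := itfg1; apply: measurableT_comp mfg1.
by move=> z /=; rewrite !in_itv/= => /andP[-> zx]; exact: le_trans zx x1.
Qed.

(** Each primitive moves by at most the L^1 distance, the drift by as much again, and the mean of
    [B] by at most as much as [B]: hence 2 + 2. *)
Lemma dxinv_dist f g x : mu.-integrable `[0, 1] (EFin \o f) ->
  mu.-integrable `[0, 1] (EFin \o g) -> 0 <= x <= 1 ->
  `|dxinv f x - dxinv g x| <= 4 * L1norm (fun y => f y - g y).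
Proof.
move=> itf itg x01; set N := L1norm _.
have N0 : 0 <= N by exact: L1norm_ge0.
have m1 : measurable (`[0%R, 1%R]%classic : set (measurableTypeR K)) by [].
have one : 0 <= (1 : K) <= 1 by rewrite ler01 lexx.
have Bd y : 0 <= y <= 1 -> `|B f y - B g y| <= 2 * N.
  move=> y01; have h1 := A_sub itf itg y01; have h2 := A_sub itf itg one.
  rewrite (_ : _ - _ = (A f y - A g y) - y * (A f 1 - A g 1)); last by rewrite /B; ring.
  apply: (le_trans (ler_normB _ _)); rewrite mulr_natl mulr2n; apply: lerD => //.
  have /andP[y0 y1] := y01.
  rewrite normrM (ger0_norm y0); apply: le_trans h2.
  by rewrite ler_piMl.
have itB := integrable_EFinB m1 (integrable_B itf) (integrable_B itg).
have -> : dxinv f x - dxinv g x =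
    (B f x - B g x) - \int[mu]_(y in `[0, 1]) (B f y - B g y).
  rewrite (@RintegralB _ _ _ mu _ _ _ m1 (integrable_B itf) (integrable_B itg)).
  by rewrite /dxinv /B /A; ring.
apply: (le_trans (ler_normB _ _)).
have : `|\int[mu]_(y in `[0, 1]) (B f y - B g y)| <= 2 * N.
  rewrite -lee_fin (EFin_normr_Rintegral m1 itB).
  have /integrableP[mB _] := itB.
  apply: (le_trans (le_abse_integral mu m1 mB)).
  rewrite -(integral_unit_cst (2 * N)); by apply: ge0_le_integral_lower => // y y01.
by have := Bd x x01; lra.
Qed.

End Dxinv.

(** * The bi-Lipschitz map F and its inverse *)

Section Finv.
Context {K : realType}.
Local Notation mu := (@lebesgue_measure K).
Variables (kappa : K) (c : K -> K).
Hypothesis kappa1 : 1 < kappa.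
Hypothesis cc : continuous c.
Hypothesis c_bounds : forall v, kappa^-1 <= c v <= kappa.
Implicit Types v w y z : K.

Let k0 : 0 < kappa. Proof. exact: lt_trans ltr01 kappa1. Qed.

Let ic v w : mu.-integrable `[v, w] (EFin \o c).
Proof.
apply: continuous_compact_integrable; first exact: segment_compact.
exact: continuous_subspaceT.
Qed.

Let split_int u v w : u <= v -> v <= w ->
  \int[mu]_(r in `[u, w]) c r = \int[mu]_(r in `[u, v]) c r + \int[mu]_(r in `[v, w]) c r.
Proof.
move=> uv vw; have := @Rintegral_itvB K c (BLeft u) (BRight w) v (ic u w).
rewrite !bnd_simp => /(_ uv vw) E.
rewrite -(@Rintegral_itv_obnd_cbnd K v) -?E; first by rewrite addrC subrK.
by apply: integrableS (ic v w) => //; exact: subset_itv_oc_cc.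
Qed.

Let empty_int v w : w <= v -> \int[mu]_(r in `[v, w]) c r = 0.
Proof.
rewrite le_eqVlt => /orP[/eqP ->|wv]; first by rewrite set_itv1 Rintegral_set1.
by rewrite set_itv_ge ?Rintegral_set0// bnd_simp -ltNge.
Qed.

Lemma FintB v w : v <= w -> Fint c w - Fint c v = \int[mu]_(r in `[v, w]) c r.
Proof.
move=> vw; rewrite /Fint.
(* For each sign pattern, one of the two integrals in every [Fint] is over an empty interval or a
   point and drops out. *)
have [v0|v0] := leP 0 v.
  have w0 : 0 <= w by exact: le_trans v0 vw.
  rewrite (empty_int v0) (empty_int w0) (split_int v0 vw); ring.
have [w0|w0] := leP 0 w.
  rewrite (empty_int w0) (empty_int (ltW v0)) (split_int (ltW v0) w0); ring.
rewrite (empty_int (ltW w0)) (empty_int (ltW v0)) (split_int vw (ltW w0)); ring.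
Qed.

Let Rcst v w (r : K) : v <= w -> \int[mu]_(_ in `[v, w]) r = r * (w - v).
Proof.
move=> vw; rewrite Rintegral_cst//; congr (_ * _).
have h : mu (`[v, w]%classic : set K) = (w - v)%:E.
  rewrite lebesgue_measure_itv/= lte_fin; case: ltP => [_|wv]; first by rewrite EFinB.
  by rewrite (@le_anti _ _ v w) ?subrr// vw.
exact: (congr1 fine h).
Qed.

Lemma Fint_ge v w : v <= w -> kappa^-1 * (w - v) <= Fint c w - Fint c v.
Proof.
move=> vw; rewrite FintB// -Rcst//; apply: le_Rintegral => //.
  apply: continuous_compact_integrable; first exact: segment_compact.
  by apply: continuous_subspaceT => x; exact: cst_continuous.
by move=> x _; have /andP[] := c_bounds x.
Qed.

Lemma Fint_le v w : v <= w -> Fint c w - Fint c v <= kappa * (w - v).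
Proof.
move=> vw; rewrite FintB// -Rcst//; apply: le_Rintegral => //.
  apply: continuous_compact_integrable; first exact: segment_compact.
  by apply: continuous_subspaceT => x; exact: cst_continuous.
by move=> x _; have /andP[] := c_bounds x.
Qed.

Let Fint0 : Fint c 0 = 0.
Proof. by rewrite /Fint subrr. Qed.

Let Fint_dist v w : `|Fint c v - Fint c w| <= kappa * `|v - w|.
Proof.
wlog vw : v w / v <= w => [H|].
  have [/H//|/ltW/H] := leP v w.
  by rewrite distrC (distrC w).
rewrite distrC (distrC v) ger0_norm; last first.
  by apply: le_trans (Fint_ge vw); rewrite mulr_ge0 ?invr_ge0 ?subr_ge0// ltW.
by rewrite (@ger0_norm _ (w - v)) ?subr_ge0//; exact: Fint_le.
Qed.

Lemma continuous_Fint : continuous (Fint c).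
Proof.
move=> v; apply/cvgrPdist_le => e e0; near=> w.
apply: (le_trans (Fint_dist v w)); rewrite mulrC -ler_pdivlMr//.
by near: w; apply: cvgr_dist_le; [exact: cvg_id|rewrite divr_gt0].
Unshelve. all: by end_near. Qed.

Lemma Fint_surj y : exists v, Fint c v = y.
Proof.
(* F vanishes at 0 and has slope at least 1/kappa, so its values at -M and M enclose [y]. *)
pose M := kappa * `|y|.
have M0 : 0 <= M by rewrite mulr_ge0// ltW.
have NM : - M <= M by lra.
have kM : kappa^-1 * M = `|y| by rewrite /M mulKf// gt_eqF.
have h1 := Fint_ge M0; rewrite Fint0 !subr0 kM in h1.
have NM0 : - M <= 0 by lra.
have h2 := Fint_ge NM0; rewrite Fint0 !sub0r opprK kM in h2.
have [||v _ <-] := @IVT K (Fint c) (- M) M y NM; last by exists v.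
  exact: continuous_subspaceT continuous_Fint.
have := ler_norm y; have := ler_norm (- y); rewrite normrN => y1 y2.
by rewrite ge_min le_max; apply/andP; split; apply/orP; [left|right]; lra.
Qed.

Lemma FinvK y : Fint c (Finv c y) = y.
Proof.
apply: (@surjpK _ _ _ _ setT) => [z _|]; last by rewrite inE.
by have [v <-] := Fint_surj z; exists v.
Qed.

(** The lower slope bound 1/kappa of F, read at the preimages of [y] and [z]. *)
Lemma Finv_dist y z : `|Finv c y - Finv c z| <= kappa * `|y - z|.
Proof.
wlog vw : y z / Finv c y <= Finv c z => [H|].
  have [/H//|/ltW/H] := leP (Finv c y) (Finv c z).
  by rewrite distrC (distrC z).
have := Fint_ge vw; rewrite !FinvK => h.
rewrite distrC ger0_norm ?subr_ge0// distrC -ler_pdivrMl//.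
exact: le_trans h (ler_norm _).
Qed.

Lemma continuous_Finv : continuous (Finv c).
Proof.
move=> v; apply/cvgrPdist_le => e e0; near=> w.
apply: (le_trans (Finv_dist v w)); rewrite mulrC -ler_pdivlMr//.
by near: w; apply: cvgr_dist_le; [exact: cvg_id|rewrite divr_gt0].
Unshelve. all: by end_near. Qed.

End Finv.

(** * Both commutators at a fixed time *)

Section FixedTime.
Context {K : realType}.
Local Notation mu := (@lebesgue_measure K).
Implicit Types (f g h q : K -> K) (x y z d A : K).
Variable J : K -> K.
Hypothesis hJ : standard_mollifier J.

Lemma L1norm_mollify_cvg f (dn : nat -> K) : mu.-integrable `[0, 1] (EFin \o f) ->
  (forall n, 0 < dn n) -> dn @ \oo --> 0 ->
  L1norm (fun x => mollify J (dn n) f x - f x) @[n --> \oo] --> (0 : K).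
Proof.
move=> itf dn0 dnc; have /fine_cvgP[_] := mollify_L1_cvg hJ itf dn0 dnc.
by [].
Qed.

Lemma integrable_mollify d f : 0 < d -> mu.-integrable `[0, 1] (EFin \o f) ->
  mu.-integrable `[0, 1] (EFin \o mollify J d f).
Proof.
move=> d0 itf; apply: continuous_compact_integrable; first exact: segment_compact.
by apply: continuous_subspaceT; exact: continuous_mollify.
Qed.

Lemma L1normD_le f g : mu.-integrable `[0, 1] (EFin \o f) ->
  mu.-integrable `[0, 1] (EFin \o g) ->
  L1norm (fun x => f x + g x) <= L1norm f + L1norm g.
Proof.
move=> itf itg.
have mI : measurable (`[0%R, 1%R]%classic : set (measurableTypeR K)) by [].
have nf : mu.-integrable `[0, 1] (EFin \o (fun x => `|f x|)) by exact: (integrable_EFin_norm itf).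
have ng : mu.-integrable `[0, 1] (EFin \o (fun x => `|g x|)) by exact: (integrable_EFin_norm itg).
rewrite /L1norm -(@RintegralD _ _ _ mu _ _ _ mI nf ng).
apply: le_Rintegral => //.
- exact: (integrable_EFin_norm (integrable_EFinD mI itf itg)).
- exact: (integrable_EFinD mI nf ng).
- by move=> x _; exact: ler_normD.
Qed.

Lemma L1normZ k f : mu.-integrable `[0, 1] (EFin \o f) ->
  L1norm (fun x => k * f x) = `|k| * L1norm f.
Proof.
move=> itf.
have mI : measurable (`[0%R, 1%R]%classic : set (measurableTypeR K)) by [].
have nf : mu.-integrable `[0, 1] (EFin \o (fun x => `|f x|)) by exact: (integrable_EFin_norm itf).
rewrite /L1norm -(@RintegralZl _ _ _ mu _ _ `|k| mI nf).
by apply: eq_Rintegral => x _; rewrite normrM.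
Qed.

Variables (kappa : K) (c : K -> K).
Hypothesis kappa1 : 1 < kappa.
Hypothesis c_derivable : forall v, derivable c v 1.
Hypothesis c_C1 : continuous (derive1 c).
Hypothesis c_bounds : forall v, kappa^-1 <= c v <= kappa.
Hypothesis dc_bound : forall v, `|derive1 c v| <= kappa.

Let k0 : 0 < kappa. Proof. exact: lt_trans ltr01 kappa1. Qed.

Let cc : continuous c.
Proof. by move=> x; exact/differentiable_continuous/derivable1_diffP. Qed.

Let c_gt0 v : 0 < c v.
Proof. by have /andP[h _] := c_bounds v; apply: lt_le_trans h; rewrite invr_gt0. Qed.

Lemma continuous_ctilde : continuous (ctilde c).
Proof.
move=> x; apply: cvgM; first exact: c_C1.
apply: cvgV; first by rewrite gt_eqF// mulr_gt0.
by apply: cvgM; [exact: cvg_cst|exact: cc].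
Qed.

(** The numerator is at most kappa and c is at least 1/kappa, so the quotient by 4c is at most
    kappa^2 / 4. *)
Lemma ctilde_le v : `|ctilde c v| <= kappa ^+ 2 / 4.
Proof.
have cv := c_gt0 v; have /andP[c1 _] := c_bounds v.
rewrite /ctilde normrM normfV (@gtr0_norm _ (4 * c v)) ?mulr_gt0//.
rewrite ler_pdivrMr ?mulr_gt0//; apply: le_trans (dc_bound v) _.
have -> : kappa ^+ 2 / 4 * (4 * c v) = kappa * (kappa * c v) by field.
have kc : 1 <= kappa * c v by rewrite mulrC -ler_pdivrMr// div1r.
by rewrite ler_peMr// ltW.
Qed.

Variables (r p s w : K -> K).
Hypothesis rp : weak_derivative r p.
Hypothesis sw : weak_derivative s w.

(** Stated for two slices instead of functions of time; [ufrak c R S t] is convertible to it at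
    [R t] and [S t], so the fixed-time results apply as they stand. *)
Definition ufrak_at (f g : K -> K) x := Finv c (dxinv (fun y => (f y - g y) / 2) x).

Let itr : mu.-integrable `[0, 1] (EFin \o r). Proof. by case: rp. Qed.
Let its : mu.-integrable `[0, 1] (EFin \o s). Proof. by case: sw. Qed.

Let mI : measurable (`[0%R, 1%R]%classic : set (measurableTypeR K)). Proof. by []. Qed.

Let it_half f g : mu.-integrable `[0, 1] (EFin \o f) ->
  mu.-integrable `[0, 1] (EFin \o g) ->
  mu.-integrable `[0, 1] (EFin \o (fun y => (f y - g y) / 2)).
Proof.
move=> itf itg; have h := integrable_EFinZ mI 2^-1 (integrable_EFinB mI itf itg).
by apply: eq_integrable h => // x _ /=; rewrite mulrC.
Qed.

Lemma continuous_ufrak_at : {within `[0, 1], continuous (ufrak_at r s)}.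
Proof.
move=> x; have h := continuous_dxinv (it_half itr its) (x := x).
by apply: cvg_comp; [exact: h|exact: (continuous_Finv kappa1 cc c_bounds)].
Qed.

Lemma measurable_comp_ufrak_at (g : K -> K) : continuous g ->
  measurable_fun (`[0, 1] : set K) (fun x => g (ufrak_at r s x)).
Proof.
move=> cg; apply: (measurableT_comp (continuous_measurable_fun cg)).
apply: subspace_continuous_measurable_fun => //; exact: continuous_ufrak_at.
Qed.

Variable dn : nat -> K.
Hypothesis dn0 : forall n, 0 < dn n < 2^-1.
Hypothesis dnc : dn @ \oo --> 0.

Let dnp n : 0 < dn n. Proof. by have /andP[] := dn0 n. Qed.

Let rn n := mollify J (dn n) r.
Let sn n := mollify J (dn n) s.

(** The difference inside [dxinv] is half of that of r - s, so the constant 4 of [dxinv_dist]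
    becomes 2 times the sum of two L^1 errors, both of which vanish; continuity of [Finv]
    concludes. *)
Lemma ufrak_at_cvg x : 0 <= x <= 1 -> ufrak_at (rn n) (sn n) x @[n --> \oo] --> ufrak_at r s x.
Proof.
move=> x01.
have itrn n : mu.-integrable `[0, 1] (EFin \o rn n) by exact: integrable_mollify.
have itsn n : mu.-integrable `[0, 1] (EFin \o sn n) by exact: integrable_mollify.
suff key : dxinv (fun y => (rn n y - sn n y) / 2) x @[n --> \oo] -->
    dxinv (fun y => (r y - s y) / 2) x.
  by apply: cvg_comp; [exact: key|exact: (continuous_Finv kappa1 cc c_bounds)].
have bnd n : `|dxinv (fun y => (r y - s y) / 2) x - dxinv (fun y => (rn n y - sn n y) / 2) x| <=
    2 * (L1norm (fun x => rn n x - r x) + L1norm (fun x => sn n x - s x)).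
  rewrite distrC; apply: (le_trans (dxinv_dist (it_half (itrn n) (itsn n)) (it_half itr its) x01)).
  have i1 := integrable_EFinB mI (itrn n) itr.
  have i2 := integrable_EFinB mI (itsn n) its.
  have i3 := integrable_EFinZ mI (-1) i2.
  have i4 := integrable_EFinD mI i1 i3.
  have -> : (fun y => (rn n y - sn n y) / 2 - (r y - s y) / 2) =
      (fun y => 2^-1 * ((rn n y - r y) + (-1) * (sn n y - s y))).
    by apply/funext => y; field.
  rewrite (L1normZ _ i4) ger0_norm ?invr_ge0//.
  have := L1normD_le i1 i3; rewrite (L1normZ _ i2) normrN1 mul1r.
  set a := L1norm _; set b := L1norm _; set e := L1norm _ => h.
  rewrite (_ : 4 * (2^-1 * a) = 2 * a); last by field.
  by rewrite ler_pM2l.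
have c1 := L1norm_mollify_cvg itr dnp dnc; have c2 := L1norm_mollify_cvg its dnp dnc.
have c3 : 2 * (L1norm (fun x => rn n x - r x) + L1norm (fun x => sn n x - s x)) @[n --> \oo] --> (0 : K).
  rewrite (_ : 0 = 2 * (0 + 0)); last by rewrite addr0 mulr0.
  by apply: cvgM; [exact: cvg_cst|exact: cvgD].
apply/cvgrPdist_le => e e0; near=> n.
apply: (le_trans (bnd n)); near: n.
exact: (cvgr_le 0).
Unshelve. all: by end_near. Qed.

Let un n := ufrak_at (rn n) (sn n).
Let u := ufrak_at r s.

Lemma first_commutator : mu.-integrable `[0, 1] (EFin \o (fun x => p x ^+ 2)) ->
  let E n x := (`|c (un n x) * derive1 (rn n) x -
                 mollify J (dn n) (fun y => c (u y) * p y) x| ^+ 2)%:E in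
  (forall n, \int[mu]_(x in `[0%R, 1%R]) E n x <=
     (4 * kappa ^+ 2)%:E * \int[mu]_(x in `[0%R, 1%R]) (p x ^+ 2)%:E)%E /\
  (\int[mu]_(x in `[0%R, 1%R]) E n x @[n --> \oo] --> 0)%E.
Proof.
move=> itp2 E.
have c_le v : `|c v| <= kappa by rewrite gtr0_norm//; have /andP[] := c_bounds v.
have itp : mu.-integrable `[0, 1] (EFin \o p) by case: rp.
have cA : {ae mu, forall x, `[0, 1]%classic x -> `|c (u x)| <= kappa} by apply: aeW => x _.
have cnA : {ae mu, forall x n, `[0, 1]%classic x -> `|c (un n x)| <= kappa}.
  by apply: aeW => x n _.
have cu : {ae mu, forall x, `[0, 1]%classic x -> c (un n x) @[n --> \oo] --> c (u x)}.
  apply: aeW => x; rewrite /= in_itv/= => x01.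
  by apply: cvg_comp; [exact: (ufrak_at_cvg x01)|exact: cc].
rewrite (_ : E = fun n x => (`|c (un n x) * mollify J (dn n) p x -
    mollify J (dn n) (fun y => c (u y) * p y) x| ^+ 2)%:E); last first.
  by apply/funext => n; apply/funext => x; rewrite /E /rn (derive1_mollify hJ x (dn0 n) rp).
exact: (@mollify_commutator K J hJ kappa p (fun x => c (u x)) (fun n x => c (un n x)) dn
  itp itp2 (measurable_comp_ufrak_at cc) cA cnA cu dnp dnc).
Qed.

(** [M] adds up the sup bounds of [r] and [s], which hold for their mollifications too, so the
    difference can be counted with the bounded coefficient. The resulting bound is quadratic in [M],
    hence of the order of squared H^1 norms. *)
Lemma second_commutator : mu.-integrable `[0, 1] (EFin \o (fun x => r x ^+ 2)) ->
  let E n x := (`|ctilde c (un n x) * (rn n x - sn n x) * rn n x -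
    mollify J (dn n) (fun y => ctilde c (u y) * (r y - s y) * r y) x| ^+ 2)%:E in
  let M := (L1norm r + L1norm p) + (L1norm s + L1norm w) in
  (forall n, \int[mu]_(x in `[0%R, 1%R]) E n x <=
     (4 * (kappa ^+ 2 / 4 * M) ^+ 2)%:E * \int[mu]_(x in `[0%R, 1%R]) (r x ^+ 2)%:E)%E /\
  (\int[mu]_(x in `[0%R, 1%R]) E n x @[n --> \oo] --> 0)%E.
Proof.
move=> itr2 E M.
have mr := integrable_measurable_fun itr; have ms := integrable_measurable_fun its.
pose b x := ctilde c (u x) * (r x - s x).
pose a n x := ctilde c (un n x) * (rn n x - sn n x).
have mb : measurable_fun (`[0, 1] : set K) b.
  apply: measurable_funM; last exact: measurable_funB.
  by apply: measurable_comp_ufrak_at; exact: continuous_ctilde.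
have bA : {ae mu, forall x, `[0, 1]%classic x -> `|b x| <= kappa ^+ 2 / 4 * M}.
  apply: ae_imp2 (ae_weak_derivative_sup hJ rp) (ae_weak_derivative_sup hJ sw) => x rM sM x01.
  rewrite normrM; apply: ler_pM => //; first exact: ctilde_le.
  by apply: (le_trans (ler_normB _ _)); apply: lerD; [exact: rM|exact: sM].
have aA : {ae mu, forall x n, `[0, 1]%classic x -> `|a n x| <= kappa ^+ 2 / 4 * M}.
  apply: aeW => x n; rewrite /= in_itv/= => x01.
  rewrite normrM; apply: ler_pM => //; first exact: ctilde_le.
  apply: (le_trans (ler_normB _ _)); apply: lerD.
    exact: (normr_mollify_sup hJ (dn0 n) rp x01).
  exact: (normr_mollify_sup hJ (dn0 n) sw x01).
have ab : {ae mu, forall x, `[0, 1]%classic x -> a n x @[n --> \oo] --> b x}.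
  apply: ae_imp2 (ae_mollify_cvg_seq hJ itr dnp dnc) (ae_mollify_cvg_seq hJ its dnp dnc) => x rc sc x01.
  apply: cvgM; last by apply: cvgB; [exact: rc|exact: sc].
  apply: cvg_comp; last exact: continuous_ctilde.
  by apply: ufrak_at_cvg; move: x01; rewrite /= in_itv.
exact: (@mollify_commutator K J hJ _ r b a dn itr itr2 mb bA aA ab dnp dnc).
Qed.

End FixedTime.

(** * Norms as functions of time, and reduction to sequences *)

Section TimeIntegral.
Context {K : realType}.
Local Notation mu := (@lebesgue_measure K).
Implicit Types (f g : K -> K) (G H : K -> K -> K) (T t x : K).

Lemma sqr_poweR (x : \bar K) : (0 <= x)%E -> (x `^ 2 = x ^+ 2)%E.
Proof.
case: x => [a| |]//; last by rewrite poweRyr ?pnatr_eq0// => _; rewrite expe2 mulyy.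
by rewrite lee_fin => a0; rewrite poweR_EFin powR_mulrn// EFin_expe.
Qed.

Lemma L2norm_sqr f : (L2norm f ^+ 2 = \int[mu]_(x in `[0%R, 1%R]) (f x ^+ 2)%:E)%E.
Proof.
rewrite -sqr_poweR ?Lnorm_ge0// /L2norm poweR_Lnorm ?pnatr_eq0// [RHS]integral_mkcond.
apply: eq_integral => x _; rewrite sqr_poweR// /patch; case: ifPn => _.
  by rewrite expe2 /= -EFinM -expr2 real_normK ?num_real.
(* Outside [0, 1] the restriction takes the default [point], which is 0 in [\bar K]. *)
by rewrite -[point]/(0%E : \bar K) abse0 expe2 mule0.
Qed.

(** Tonelli's theorem for the square extended by 0 outside the rectangle, where joint measurability
    is given. *)
Lemma measurable_sqr_slice T H : jointly_measurable T H ->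
  measurable_fun (`[0, T] : set K) (fun t => \int[mu]_(x in `[0%R, 1%R]) (H t x ^+ 2)%:E)%E.
Proof.
move=> mH.
pose D := (`[0, T] `*` `[0, 1])%classic : set (measurableTypeR K * measurableTypeR K)%type.
pose k := (fun p : K * K => (H p.1 p.2 ^+ 2)%:E) \_ D.
have mD : measurable D by apply: measurableX; exact: measurable_itv.
have mk : measurable_fun [set: (measurableTypeR K * measurableTypeR K)%type] k.
  apply/(measurable_restrictT _ _).1 => //.
  by apply/measurable_EFinP; exact: measurable_funX.
have k0 p : (0 <= k p)%E.
  by rewrite /k /patch; case: ifP => // _; rewrite lee_fin sqr_ge0.
have mF := measurable_fun_fubini_tonelli_F (m2 := mu) k mk k0.
apply: (eq_measurable_fun (fubini_F mu k)); last exact: measurable_funS mF.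
move=> t; rewrite inE /= => tT.
rewrite /fubini_F [RHS]integral_mkcond; apply: eq_integral => x _.
rewrite /k /patch; congr (if _ then _ else _).
by apply/idP/idP; rewrite !inE /D /=; [case|move=> ->].
Qed.

Lemma integrable_of_sqr f : measurable_fun (`[0, 1] : set K) f ->
  (\int[mu]_(x in `[0%R, 1%R]) (f x ^+ 2)%:E < +oo)%E ->
  mu.-integrable `[0, 1] (EFin \o (fun x => f x ^+ 2)).
Proof.
move=> mf foo; apply/integrableP; split.
  by apply/measurable_EFinP; exact: measurable_funX.
by under eq_integral do rewrite /= ger0_norm ?sqr_ge0//.
Qed.

(** If the limit failed, some [e] would be exceeded at arbitrarily small d; picking such a point
    below both [e0] and 1/(n+1) for each n gives a sequence contradicting [Fseq]. *)
Lemma cvg_at_right_ereal (F : K -> \bar K) (e0 : K) : 0 < e0 ->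
  (forall d, (0 <= F d)%E) ->
  (forall dn : nat -> K, (forall n, 0 < dn n < e0) -> dn @ \oo --> 0 ->
     (F (dn n) @[n --> \oo] --> 0)%E) ->
  (F d @[d --> 0^'+] --> 0)%E.
Proof.
move=> e00 F0 Fseq.
apply: ge0_cvge0 => // e e1; apply: contrapT => nF.
have /choice[dn dnP] n : exists d, [/\ 0 < d < e0, d < n.+1%:R^-1 & (e%:E < F d)%E].
  apply: contrapT => nd; apply: nF; near=> d.
  have d1 : 0 < d by near: d; exact: nbhs_right_gt.
  have d2 : d < e0 by near: d; exact: nbhs_right_lt.
  have d3 : d < n.+1%:R^-1 by near: d; apply: nbhs_right_lt; rewrite invr_gt0.
  rewrite leNgt; apply/negP => ed; apply: nd; exists d; split => //.
  exact/andP.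
have dn0 : dn @ \oo --> 0.
  apply: (@squeeze_cvgr _ _ _ _ (cst 0) (@harmonic K)).
  - apply: nearW => n; have [/andP[/ltW d0 _] /ltW d1 _] := dnP n.
    by rewrite d0 d1.
  - exact: cvg_cst.
  - exact: cvg_harmonic.
have dn1 n : 0 < dn n < e0 by have [] := dnP n.
have /fine_cvgP[Ffin Fc] := Fseq dn dn1 dn0.
have : \forall n \near \oo, False.
  near=> n; have [_ _] := dnP n.
  have Ff : F (dn n) \is a fin_num by near: n.
  have : fine (F (dn n)) < e by near: n; exact: (cvgr_lt 0).
  by rewrite -lte_fin fineK// => /lt_trans h /h; rewrite ltxx.
by move=> [N _ /(_ N (leqnn N))].
Unshelve. all: by end_near. Qed.

Lemma Linf_L2_bound T G : in_Linf_L2 T G -> exists m : K,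
  {ae mu, forall t, `[0, T]%classic t ->
    (\int[mu]_(x in `[0%R, 1%R]) (G t x ^+ 2)%:E <= m%:E)%E}.
Proof.
(* The norm of exponent infinity is the essential supremum only when the whole space has positive
   measure; [0, 1], of measure 1, excludes the other case. *)
move=> [_]; rewrite unlock /Lnorm; case: ifPn => [_|]; last first.
  move=> /negP []; rewrite lt_neqAle measure_ge0 andbT eq_sym; apply/eqP => m0.
  have : (mu (`[0%R, 1%R]%classic : set K) <= mu setT)%E by apply: le_measure; rewrite ?inE.
  by rewrite lebesgue_measure_unit_itv m0 lee_fin ler10.
set ess := ess_sup _ _ => essoo.
(* The essential supremum is only known to be below +oo, so it is replaced by a real upper bound
   that is nonnegative and can be squared. *)
have [m [em m0]] : exists m : K, (ess <= m%:E)%E /\ 0 <= m.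
  case: ess essoo => [r| |]// _; last by exists 0; rewrite leNye.
  by exists (Num.max r 0); rewrite lee_fin !le_max !lexx orbT.
exists (m ^+ 2); have := ess_sup_ge mu (abse \o ((fun t => L2norm (G t)) \_ `[0, T])).
apply: ae_imp => t /= h tT.
have : (`|L2norm (G t)| <= m%:E)%E.
  by apply: le_trans em; move: h; rewrite /patch mem_set.
rewrite gee0_abs ?Lnorm_ge0// => h2; rewrite -L2norm_sqr.
rewrite EFin_expe !expe2; apply: lee_pmul => //; exact: Lnorm_ge0.
Qed.

End TimeIntegral.

(** * Dominated convergence in time *)

Section TimeStep.
Context {K : realType}.
Local Notation mu := (@lebesgue_measure K).

(** The dominator C V is the same for all indices, so this is dominated convergence for an integrand
    that may fail to be measurable in time. The exceptional set of times may depend on the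
    sequence. *)
Lemma integral_time_cvg0 (T C : K) (V : K -> \bar K) (E : K -> K -> \bar K) :
  0 <= C -> measurable_fun (`[0, T] : set K) V -> (forall t, (0 <= V t)%E) ->
  (\int[mu]_(t in `[0%R, T]) V t < +oo)%E -> (forall d t, (0 <= E d t)%E) ->
  (forall dn : nat -> K, (forall n, 0 < dn n < 2^-1) -> dn @ \oo --> 0 ->
    {ae mu, forall t, `[0, T]%classic t ->
      (forall n, (E (dn n) t <= C%:E * V t)%E) /\ (E (dn n) t @[n --> \oo] --> 0)%E}) ->
  (\int[mu]_(t in `[0%R, T]) E d t @[d --> 0^'+] --> 0)%E.
Proof.
move=> C0 mV V0 intV E0 EV.
have mI : measurable (`[0%R, T]%classic : set (measurableTypeR K)) by [].
have mCV : measurable_fun (`[0%R, T]%classic : set (measurableTypeR K)) (fun t => C%:E * V t)%E.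
  exact: measurable_funeM.
apply: (@cvg_at_right_ereal _ _ 2^-1); first by rewrite invr_gt0.
  by move=> d; exact: integral_ge0.
move=> dn dn0 dnc; have EV' := EV dn dn0 dnc.
apply: (@lower_pratt _ _ _ mu _ _ (fun _ t => C%:E * V t)%E (fun t => C%:E * V t)%E) => //.
- by move=> n x _; rewrite mule_ge0.
- by move=> x _; rewrite mule_ge0.
- rewrite (@ge0_integralZl_EFin _ _ _ mu _ mI V (fun x _ => V0 x) mV C C0).
  by rewrite lte_mul_pinfty.
- by apply: ae_imp EV' => t tP n tT; have [h _] := tP tT; exact: h.
- by apply: ae_imp EV' => t tP tT; have [_ h] := tP tT; exact: h.
- by apply: aeW => t _; exact: cvg_cst.
Qed.

End TimeStep.

(** * The two limits *)

Unset Implicit Arguments.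

Theorem lemma4p3 (K : realType) (T : K) (hT : 0 < T)
  (kappa : K) (hkappa : 1 < kappa)
  (c : K -> K)
  (c_derivable : forall v, derivable c v 1)
  (c_C1 : continuous (derive1 c))
  (c_bounds : forall v, kappa^-1 <= c v <= kappa)
  (dc_bound : forall v, `|derive1 c v| <= kappa)
  (J : K -> K) (hJ : standard_mollifier J)
  (R S : K -> K -> K)
  (R_Linf_L2 : in_Linf_L2 T R) (R_L2_H1 : in_L2_H1 T R)
  (S_Linf_L2 : in_Linf_L2 T S) (S_L2_H1 : in_L2_H1 T S)
  (dxR : K -> K -> K) (hdxR : weak_dx T R dxR) :
  let mu := @lebesgue_measure K in
  let Rd := fun delta t => mollify J delta (R t) in
  let Sd := fun delta t => mollify J delta (S t) in
  let u := ufrak c R S in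
  let ud := fun delta => ufrak c (Rd delta) (Sd delta) in
  ((\int[mu]_(t in `[0%R, T]) \int[mu]_(x in `[0%R, 1%R])
      (`|c (ud delta t x) * derive1 (Rd delta t) x
         - mollify J delta (fun y => c (u t y) * dxR t y) x| ^+ 2)%:E)%E
     @[delta --> 0^'+] --> 0%E) /\
  ((\int[mu]_(t in `[0%R, T]) \int[mu]_(x in `[0%R, 1%R])
      (`|ctilde c (ud delta t x) * (Rd delta t x - Sd delta t x) * Rd delta t x
         - mollify J delta
             (fun y => ctilde c (u t y) * (R t y - S t y) * R t y) x| ^+ 2)%:E)%E
     @[delta --> 0^'+] --> 0%E).
Proof.
move=> mu Rd Sd u ud.
have [m mR] := Linf_L2_bound R_Linf_L2.
have [jR [HR [jHR wHR] intR]] := R_L2_H1.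
have [jS [HS [jHS wHS] intS]] := S_L2_H1.
have [_ wdxR] := hdxR.
pose Q (G : K -> K -> K) t := (\int[mu]_(x in `[0%R, 1%R]) (G t x ^+ 2)%:E)%E.
have Q0 G t : (0 <= Q G t)%E by apply: integral_ge0 => x _; rewrite lee_fin sqr_ge0.
have mQ G : jointly_measurable T G -> measurable_fun (`[0, T] : set K) (Q G).
  by move=> jG; exact: (measurable_sqr_slice jG).
(* [HR] and [HS] are the derivatives that come with the H^1 membership; it is for them that the time
   integral is given to be finite. *)
pose V t := ((Q R t + Q HR t) + (Q S t + Q HS t))%E.
have V0 t : (0 <= V t)%E by apply: adde_ge0; apply: adde_ge0; exact: Q0.
have mI : measurable (`[0%R, T]%classic : set (measurableTypeR K)) by [].
have mV : measurable_fun (`[0, T] : set K) V.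
  by apply: emeasurable_funD; apply: emeasurable_funD; exact: mQ.
have intV : (\int[mu]_(t in `[0%R, T]) V t < +oo)%E.
  rewrite ge0_integralD//; first last.
  - by apply: emeasurable_funD; exact: mQ.
  - by move=> t _; exact: adde_ge0.
  - by apply: emeasurable_funD; exact: mQ.
  - by move=> t _; exact: adde_ge0.
  apply: lte_add_pinfty; [move: intR|move: intS]; apply: le_lt_trans;
    rewrite le_eqVlt; apply/orP; left; apply/eqP; apply: eq_integral => t _;
    by rewrite !L2norm_sqr.
have itV : mu.-integrable `[0, T] V.
  apply/integrableP; split => //.
  by under eq_integral do rewrite gee0_abs//.
have Vfin := integrable_ae mI itV.
(* Finiteness of [V t] makes the slices and their derivatives square integrable at that time; [m]
   bounds the squared L^2 norm of [R t]. *)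
pose good t := [/\ weak_derivative (R t) (HR t), weak_derivative (R t) (dxR t),
  weak_derivative (S t) (HS t), V t \is a fin_num & (Q R t <= m%:E)%E].
have ae_good : {ae mu, forall t, `[0, T]%classic t -> good t}.
  have h1 := ae_imp2 (fun t p1 p2 => conj p1 p2) wHR wdxR.
  have h2 := ae_imp2 (fun t p1 p2 => conj p1 p2) wHS Vfin.
  have h3 := ae_imp2 (fun t p1 p2 => conj p1 p2) h1 h2.
  apply: ae_imp2 h3 mR => t [[p1 p2] [p3 p4]] p5 tT.
  have tT' : t \in `[0, T] by [].
  by split; [exact: p1|exact: p2|exact: p3|exact: p4|exact: p5].
have QV t : [/\ (Q R t <= V t)%E, (Q HR t <= V t)%E, (Q S t <= V t)%E & (Q HS t <= V t)%E].
  have Q12 : (0 <= Q R t + Q HR t)%E by exact: adde_ge0.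
  have Q34 : (0 <= Q S t + Q HS t)%E by exact: adde_ge0.
  by split; rewrite /V;
    [rewrite -addeA leeDl// adde_ge0|rewrite addeAC leeDr// adde_ge0|
     rewrite addeA addeAC leeDr// adde_ge0|rewrite addeA leeDr// adde_ge0].
have Qfin t : V t \is a fin_num -> [/\ (Q R t < +oo)%E, (Q HR t < +oo)%E,
    (Q S t < +oo)%E & (Q HS t < +oo)%E].
  rewrite ge0_fin_numE// => Voo; have [v1 v2 v3 v4] := QV t.
  by split; [exact: le_lt_trans v1 Voo|exact: le_lt_trans v2 Voo|
    exact: le_lt_trans v3 Voo|exact: le_lt_trans v4 Voo].
have weak_int f g : weak_derivative f g -> mu.-integrable `[0, 1] (EFin \o f) /\
    mu.-integrable `[0, 1] (EFin \o g) by case.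
have sqr_int f : mu.-integrable `[0, 1] (EFin \o f) ->
    (\int[mu]_(x in `[0%R, 1%R]) (f x ^+ 2)%:E < +oo)%E ->
    mu.-integrable `[0, 1] (EFin \o (fun x => f x ^+ 2)).
  by move=> itf; apply: integrable_of_sqr; exact: integrable_measurable_fun.
(* At a good time [dxR t] and [HR t] are weak derivatives of the same function, hence equal almost
   everywhere, so [V] also controls [dxR]. *)
have QdxR t : good t -> Q dxR t = Q HR t.
  move=> [p1 p2 _ _ _]; have [_ i1] := weak_int _ _ p1; have [_ i2] := weak_int _ _ p2.
  apply: ge0_ae_eq_integral => //.
  - apply/measurable_EFinP; apply: measurable_funX; exact: integrable_measurable_fun.
  - apply/measurable_EFinP; apply: measurable_funX; exact: integrable_measurable_fun.
  - by move=> x _; rewrite lee_fin sqr_ge0.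
  - by move=> x _; rewrite lee_fin sqr_ge0.
  - by apply: ae_imp (weak_derivative_unique hJ p2 p1) => x xP x01; rewrite xP.
split.
- apply: (@integral_time_cvg0 _ T (4 * kappa ^+ 2) V) => //.
  + by rewrite mulr_ge0// sqr_ge0.
  + by move=> d t; apply: integral_ge0 => x _; rewrite lee_fin sqr_ge0.
  move=> dn dn0 dnc; apply: ae_imp ae_good => t tG tT; have gt := tG tT.
  have [p1 p2 p3 p4 p5] := gt; have [q1 q2 q3 q4] := Qfin t p4.
  have [_ i2] := weak_int _ _ p2.
  have it2 : mu.-integrable `[0, 1] (EFin \o (fun x => dxR t x ^+ 2)).
    by apply: sqr_int => //; rewrite -/(Q dxR t) QdxR.
  have [b1 b2] := first_commutator hJ hkappa c_derivable c_bounds p2 p3 dn0 dnc it2.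
  split; last exact: b2.
  move=> n; apply: (le_trans (b1 n)); apply: lee_wpmul2l.
    by rewrite lee_fin mulr_ge0// sqr_ge0.
  by rewrite -/(Q dxR t) QdxR//; have [_ ->] := QV t.
(* A factor 4 comes from the commutator bound and another 4 from squaring a sum of four L^1 norms;
   kappa^2 / 4 bounds [ctilde c], and the maximum with 0 keeps [C] nonnegative. *)
- pose C := 16 * (kappa ^+ 2 / 4) ^+ 2 * Num.max m 0.
  have C0 : 0 <= C.
    by apply: mulr_ge0; [rewrite mulr_ge0// sqr_ge0|rewrite le_max lexx orbT].
  apply: (@integral_time_cvg0 _ T C V) => //.
  + by move=> d t; apply: integral_ge0 => x _; rewrite lee_fin sqr_ge0.
  move=> dn dn0 dnc; apply: ae_imp ae_good => t tG tT; have gt := tG tT.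
  have [p1 p2 p3 p4 p5] := gt; have [q1 q2 q3 q4] := Qfin t p4.
  have [i1 i2] := weak_int _ _ p1; have [i3 i4] := weak_int _ _ p3.
  have j1 := sqr_int _ i1 q1; have j2 := sqr_int _ i2 q2.
  have j3 := sqr_int _ i3 q3; have j4 := sqr_int _ i4 q4.
  have [b1 b2] := second_commutator hJ hkappa c_derivable c_C1 c_bounds dc_bound p1 p3 dn0 dnc j1.
  split; last exact: b2.
  move=> n; apply: (le_trans (b1 n)).
  have n1 := sqr_L1norm_le i1 j1; have n2 := sqr_L1norm_le i2 j2.
  have n3 := sqr_L1norm_le i3 j3; have n4 := sqr_L1norm_le i4 j4.
  move: p4 n1 n2 n3 n4; rewrite -/(Q R t) -/(Q HR t) -/(Q S t) -/(Q HS t) /V.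
  have f1 : Q R t \is a fin_num by rewrite ge0_fin_numE.
  have f2 : Q HR t \is a fin_num by rewrite ge0_fin_numE.
  have f3 : Q S t \is a fin_num by rewrite ge0_fin_numE.
  have f4 : Q HS t \is a fin_num by rewrite ge0_fin_numE.
  have m0 : (Q R t <= (Num.max m 0)%:E)%E by apply: (le_trans p5); rewrite lee_fin le_max lexx.
  move: m0 (Q0 R t); rewrite -(fineK f1) -(fineK f2) -(fineK f3) -(fineK f4).
  rewrite -!EFinD -!EFinM !lee_fin.
  set a1 := fine _; set a2 := fine _; set a3 := fine _; set a4 := fine _.
  set l1 := L1norm _; set l2 := L1norm _; set l3 := L1norm _; set l4 := L1norm _.
  rewrite /C; set M := Num.max m 0; set k := kappa ^+ 2 / 4.
  move=> aM a0 _ n1 n2 n3 n4.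
  have h : (l1 + l2 + (l3 + l4)) ^+ 2 <= 4 * (a1 + a2 + (a3 + a4)).
    (* The six squared differences add up to four times the sum of the squares minus the square of
       the sum. *)
    have := sqr_ge0 (l1 - l2); have := sqr_ge0 (l1 - l3); have := sqr_ge0 (l1 - l4).
    have := sqr_ge0 (l2 - l3); have := sqr_ge0 (l2 - l4); have := sqr_ge0 (l3 - l4).
    by nra.
  rewrite exprMn.
  have -> : 4 * (k ^+ 2 * (l1 + l2 + (l3 + l4)) ^+ 2) * a1 =
     4 * k ^+ 2 * ((l1 + l2 + (l3 + l4)) ^+ 2 * a1) by ring.
  have -> : 16 * k ^+ 2 * M * (a1 + a2 + (a3 + a4)) =
     4 * k ^+ 2 * (4 * (a1 + a2 + (a3 + a4)) * M) by ring.
  apply: ler_wpM2l; first by rewrite mulr_ge0// sqr_ge0.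
  by apply: ler_pM => //; exact: sqr_ge0.
Qed.
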